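(* Fix a 2-dimensional linear subspace $L\subset\mathbb{R}^d$. As $t\to\infty$ and $\delta_t\to 0$, $$\mathbb{E}_V\,\overline{\mathrm{cr}}(G_L)=\tfrac18\,c_d\,t^4\delta_t^{2d+2}\,I^{(2)}(W,L)+o\bigl(t^4\delta_t^{2d+2}\bigr).$$
   Context: Setup. Let $d\ge 2$ and let $W\subset\mathbb{R}^d$ be a compact convex set with $\mathrm{vol}_d(W)=1$. For $t>0$, $V$ is a Poisson point process of intensity $t$ on $W$ (equivalently: draw $N\sim\mathrm{Poisson}(t)$ and then $N$ i.i.d. uniform points in $W$). $(\delta_t)_{t>0}$ is a family of positive reals. The random geometric graph $G$ has vertex set $V$ and a straight-segment edge between distinct $u,v\in V$ iff $\|u-v\|\le\delta_t$. For a 2-dimensional linear subspace $L$, $x|_L$ is the orthogonal projection of a point or set onto $L$, $L^\perp$ the $(d-2)$-dimensional orthogonal complement, and $G_L$ the straight-line drawing of $G$ projected onto $L$. With $[u,v]$ the segment between $u,v$ and $V^4_{\neq}$ the ordered 4-tuples of pairwise distinct points of $V$, the rectilinear crossing number of $G_L$ is $$\overline{\mathrm{cr}}(G_L)=\tfrac18\sum_{(v_1,\dots,v_4)\in V^4_{\neq}}\mathbf 1\bigl([v_1,v_2]|_L\cap[v_3,v_4]|_L\neq\emptyset\bigr)\mathbf 1(\|v_1-v_2\|\le\delta_t)\mathbf 1(\|v_3-v_4\|\le\delta_t).$$ $B_d$ is the unit ball of $\mathbb{R}^d$, $\kappa_d=\mathrm{vol}_d(B_d)$, and $2B_2$ the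 disc of radius $2$ centered at $0$ in $L$. The constant $$c_d=\int_{B_d\times 2B_2\times B_d}\mathbf 1\bigl([0,x|_L]\cap(y+[0,z|_L])\neq\emptyset\bigr)\,dz\,dy\,dx$$ (with $y$ integrated w.r.t. 2-dimensional Lebesgue measure on $L$) does not depend on $L$. For $k\ge1$, $I^{(k)}(W,L)=\int_{W|_L}\mathrm{vol}_{d-2}\bigl((u+L^\perp)\cap W\bigr)^k\,du$ (2-dimensional Lebesgue measure on $L$). $\mathbb{E}_V,\mathrm{Var}_V$ denote expectation/variance with respect to $V$. *)

(* Defs.v *)
From HB Require Import structures.
From mathcomp Require Import all_boot all_order all_algebra.
From mathcomp Require Import all_classical all_reals all_analysis.
Set Implicit Arguments. Unset Strict Implicit. Unset Printing Implicit Defensive.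
Import Order.TTheory GRing.Theory Num.Theory.
Import numFieldNormedType.Exports.
Local Open Scope classical_set_scope.
Local Open Scope ring_scope.

Section Defs.
Variable R : realType.

(* Euclidean norm on row vectors (the matrix norm of MathComp is the sup norm). *)
Definition enorm (n : nat) (x : 'rV[R]_n) : R := Num.sqrt (\sum_(i < n) x ord0 i ^+ 2).

(* n-dimensional Lebesgue integral of a nonnegative function on R^n, written as
   the iterated one-dimensional Lebesgue integral (Tonelli). *)
Fixpoint lebint (n : nat) : ('rV[R]_n -> \bar R) -> \bar R :=
  match n return ('rV[R]_n -> \bar R) -> \bar R with
  | 0 => fun f => f 0
  | n'.+1 => fun f =>
      (\int[@lebesgue_measure R]_x lebint (fun v : 'rV[R]_n' => f (row_mx (\row_(_ < 1) x) v)))%E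
  end.

Definition vol (n : nat) (A : set 'rV[R]_n) : \bar R := lebint (fun x => (\1_A x)%:E).

(* the frame: the rows of an orthogonal matrix Q; L is spanned by rows 0 and 1,
   L^perp by rows 2, ..., k+1 (d = k+2). *)
Variable k : nat.
Variable Q : 'M[R]_(k.+2).

Definition projL (x : 'rV[R]_(k.+2)) : 'rV[R]_(k.+2) := x *m Q^T *m pid_mx 2 *m Q.
Definition embL (u : 'rV[R]_2) : 'rV[R]_(k.+2) := row_mx u (0 : 'rV[R]_k) *m Q.
Definition embLp (w : 'rV[R]_k) : 'rV[R]_(k.+2) := row_mx (0 : 'rV[R]_2) w *m Q.

Definition segment (n : nat) (a b : 'rV[R]_n) : set 'rV[R]_n :=
  [set (1 - s) *: a + s *: b | s in `[0, 1]%classic].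

Definition crossL (v1 v2 v3 v4 : 'rV[R]_(k.+2)) : Prop :=
  (projL @` segment v1 v2) `&` (projL @` segment v3 v4) !=set0.

Definition crL (delta : R) (s : seq 'rV[R]_(k.+2)) : R :=
  8^-1 * \sum_(i1 < size s) \sum_(i2 < size s) \sum_(i3 < size s) \sum_(i4 < size s)
    (([&& i1 != i2, i1 != i3, i1 != i4, i2 != i3, i2 != i4 & i3 != i4]
      && `[< crossL (nth 0 s i1) (nth 0 s i2) (nth 0 s i3) (nth 0 s i4) >]
      && (enorm (nth 0 s i1 - nth 0 s i2) <= delta)
      && (enorm (nth 0 s i3 - nth 0 s i4) <= delta)) : bool)%:R.

(* E[f(X_1,...,X_n)] for X_i i.i.d. uniform on W (vol W = 1, density 1_W) *)
Fixpoint unifE (W : set 'rV[R]_(k.+2)) (n : nat) (f : seq 'rV[R]_(k.+2) -> \bar R) : \bar R :=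
  match n with
  | 0 => f [::]
  | n'.+1 => lebint (fun x => ((\1_W x)%:E * unifE W n' (fun s => f (x :: s)))%E)
  end.

(* E_V of crL for V a Poisson process of intensity t on W:
   N ~ Poisson(t), then N i.i.d. uniform points of W *)
Definition Ecr (W : set 'rV[R]_(k.+2)) (delta t : R) : \bar R :=
  (\sum_(n <oo) ((expR (- t) * t ^+ n / n`!%:R)%:E * unifE W n (fun s => (crL delta s)%:E)))%E.

(* c_d, with y in L parametrized isometrically by R^2 *)
Definition cd : \bar R :=
  lebint (fun x : 'rV[R]_(k.+2) => ((\1_[set x | enorm x <= 1] x)%:E *
    lebint (fun y : 'rV[R]_2 => ((\1_[set y | enorm y <= 2] y)%:E *
      lebint (fun z : 'rV[R]_(k.+2) => ((\1_[set z | enorm z <= 1] z)%:E *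
        (`[< segment 0 (projL x) `&` [set embL y + p | p in segment 0 (projL z)] !=set0 >])%:R%:E)%E))%E))%E).

(* I^(2)(W,L), with u in L parametrized isometrically by R^2 and L^perp by R^k *)
Definition I2 (W : set 'rV[R]_(k.+2)) : \bar R :=
  lebint (fun u : 'rV[R]_2 =>
    ((\1_(projL @` W) (embL u))%:E *
     (vol [set w : 'rV[R]_k | W (embL u + embLp w)%R] * vol [set w : 'rV[R]_k | W (embL u + embLp w)%R]))%E).

End Defs.

(* Main.v *)
Require Import Defs.
From HB Require Import structures.
From mathcomp Require Import all_boot all_order all_algebra.
From mathcomp Require Import all_classical all_reals all_analysis.
From mathcomp Require Import measurable_realfun zify ring lra.

(** By the factorial moments of the Poisson law, the expectation is t^4/8 times the probability J
    that four independent uniform points form two short crossing segments.  Substituting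
    v2 = v1 + delta x, v3 = v1 + delta y + w with y in L and w in L^perp, v4 = v3 + delta z gives
    J = delta^(2d+2) \int chi(x,y,z) Phi_delta(x,y,z), where chi integrates to c_d and Phi_delta is
    the measure of the pairs (v,q) in the same fibre of the projection to L such that v, q and
    their translates v + delta x, q + delta y, q + delta (y + z) lie in W.  Uniformly on the support
    of chi, Phi_delta tends to I^(2)(W,L): moving a point by less than r changes the indicator of W,
    in L^1 norm, by a multiple of vol(W_r \ W), where W_r is the r-neighbourhood of W; this
    tends to 0 as W is closed. *)

Set Implicit Arguments.
Unset Strict Implicit.
Unset Printing Implicit Defensive.
Import Order.TTheory GRing.Theory Num.Theory.
Import numFieldNormedType.Exports.
Local Open Scope classical_set_scope.
Local Open Scope ring_scope.

(** * Lebesgue measure on row vectors *)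

(** The definitions are iterated one-dimensional integrals. Exchanging or substituting variables in
    them requires joint measurability of every partial integrand. So a sigma-finite measure [lebm]
    is built by the same recursion, and measurability is carried in forms stable under partial
    integration: [nnm] for functions, [seq_nnm] for functionals of point lists. The delicate
    integrand is the crossing indicator, an existential over real parameters. The frame [Q] is
    arbitrary while [lebm] is tied to the coordinate axes, so rotation invariance is proved before L
    and L^perp are separated. Phi_delta couples two points through a common fibre. As W is bounded,
    its fibres have volume at most some constant C, so an L^1 error in one of the points costs at
    most C times that error in the pair integral. Three shifted points give the constant 3C. Since
    chi has bounded support and finite integral c_d, the final error is at most 3C c_d vol(W_r \
    W). *)

Section rV_measurable.
Context {R : realType}.
Variable n : nat.

(** The sigma-algebra generated by the coordinates turns measurability of a vector-valued map into a
    coordinatewise check; [open_measurable_rV] shows that it contains the Borel sets. *)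
Let coors : 'I_n -> 'rV[R]_n -> measurableTypeR R := fun i x => x ord0 i.

Let rV_set0 : g_sigma_preimage coors set0.
Proof. exact: sigma_algebra0. Qed.

Let rV_setC A : g_sigma_preimage coors A -> g_sigma_preimage coors (~` A).
Proof. exact: sigma_algebraC. Qed.

Let rV_bigcup (F : _^nat) : (forall i, g_sigma_preimage coors (F i)) ->
  g_sigma_preimage coors (\bigcup_i (F i)).
Proof. exact: sigma_algebra_bigcup. Qed.

HB.instance Definition _ := @isMeasurable.Build (measure_tuple_display default_measure_display)
  'rV[R]_n (g_sigma_preimage coors) rV_set0 rV_setC rV_bigcup.

End rV_measurable.

Section rV_measurable_fun.
Context {R : realType} d (T : measurableType d).
Implicit Types (n : nat).

Lemma measurable_fun_rVP n (f : T -> 'rV[R]_n) :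
  measurable_fun setT f <-> forall i, measurable_fun setT (fun t => f t ord0 i).
Proof.
pose co (i : 'I_n) (x : 'rV[R]_n) : measurableTypeR R := x ord0 i.
apply: (@iff_trans _ (g_sigma_preimage
    (fun i => (co i : 'rV[R]_n -> _) \o f) `<=` measurable)).
  rewrite (g_sigma_preimage_comp co f); split=> [mf A [/= C preC <-]|prefS].
    exact: mf.
  by move=> _ A mA; apply: prefS; exists A.
split=> [tnthfS i|mf].
- move=> _ A mA.
  apply: tnthfS; apply: sub_sigma_algebra.
  case: n i @co f => [[] []//|m i co f].
  rewrite -bigcup_mkord_ord.
  exists i; first exact: ltn_ord.
  by exists A => //; rewrite inord_val.
- apply: smallest_sub; first exact: sigma_algebra_measurable.
  case: n @co f mf => [co f mf|m co f mf]; first by rewrite big_ord0.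
  rewrite -bigcup_mkord_ord; apply: bigcup_sub => i Ii.
  by move=> A [C mC <-]; exact: mf.
Qed.


Lemma measurable_coord n (f : T -> 'rV[R]_n) i :
  measurable_fun setT f -> measurable_fun setT (fun t => f t ord0 i).
Proof. by move=> /measurable_fun_rVP. Qed.

Lemma measurable_addV n (f g : T -> 'rV[R]_n) :
  measurable_fun setT f -> measurable_fun setT g ->
  measurable_fun setT (fun t => f t + g t).
Proof.
move=> /measurable_fun_rVP mf /measurable_fun_rVP mg; apply/measurable_fun_rVP => i.
by under eq_fun do rewrite mxE; exact: measurable_funD.
Qed.

Lemma measurable_scaleV n (c : T -> R) (f : T -> 'rV[R]_n) :
  measurable_fun setT c -> measurable_fun setT f ->
  measurable_fun setT (fun t => c t *: f t).
Proof.
move=> mc /measurable_fun_rVP mf; apply/measurable_fun_rVP => i.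
by under eq_fun do rewrite mxE; exact: measurable_funM.
Qed.

Lemma measurable_oppV n (f : T -> 'rV[R]_n) :
  measurable_fun setT f -> measurable_fun setT (fun t => - f t).
Proof.
move=> mf; under eq_fun do rewrite -scaleN1r.
exact: measurable_scaleV.
Qed.

Lemma measurable_mulmxV m n (f : T -> 'rV[R]_m) (A : 'M[R]_(m, n)) :
  measurable_fun setT f -> measurable_fun setT (fun t => f t *m A).
Proof.
move=> /measurable_fun_rVP mf; apply/measurable_fun_rVP => i.
under eq_fun do rewrite mxE; apply: measurable_sum => j.
exact: measurable_funM.
Qed.

Lemma measurable_row_mxV m n (f : T -> 'rV[R]_m) (g : T -> 'rV[R]_n) :
  measurable_fun setT f -> measurable_fun setT g ->
  measurable_fun setT (fun t => row_mx (f t) (g t)).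
Proof.
move=> /measurable_fun_rVP mf /measurable_fun_rVP mg; apply/measurable_fun_rVP => i.
by under eq_fun do rewrite mxE; case: (fintype.split i) => j; [exact: mf|exact: mg].
Qed.

Lemma measurable_row1 (f : T -> R) :
  measurable_fun setT f -> measurable_fun setT (fun t => \row_(_ < 1) f t : 'rV[R]_1).
Proof.
move=> mf; apply/measurable_fun_rVP => i.
by under eq_fun do rewrite mxE.
Qed.

End rV_measurable_fun.

Section open_measurable.
Context {R : realType}.

Lemma measurable_ball_rV n (x : 'rV[R]_n) r : measurable (ball x r).
Proof.
have [r0|r0] := ltP 0 r; last first.
  rewrite (_ : ball x r = set0)//; apply/seteqP; split=> // y [].
  by rewrite ltNge r0.
rewrite (_ : ball x r = \bigcap_(i in [set: 'I_n])
   ((fun y : 'rV[R]_n => y ord0 i) @^-1` (ball (x ord0 i) r))); last first.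
  apply/seteqP; split => y /=.
    by move=> [_ yr] i _; exact: yr.
  move=> yr; split=> // i j; rewrite (ord1 i); exact: yr.
apply: fin_bigcap_measurable => // i _.
rewrite -[X in measurable X]setTI.
apply: measurable_coord => //; exact: measurable_ball.
Qed.

(** An open set is the union of those balls with rational centre and rational radius that it
    contains, and these are countably many. *)
Lemma open_measurable_rV n (A : set 'rV[R]_n) : open A -> measurable A.
Proof.
move=> oA.
pose B (p : 'rV[rat]_n * rat) : set 'rV[R]_n :=
    ball (\row_i ratr (p.1 ord0 i) : 'rV[R]_n) (ratr p.2 : R).
rewrite (_ : A = \bigcup_(p in [set p | B p `<=` A]) B p); last first.
  apply/seteqP; split => [x Ax|x [p pA Bp]]; last exact: pA.
  have /nbhs_ballP[e /= e0 xeA] := open_nbhs_nbhs (conj oA Ax).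
  (* Below e / 2: a rational centre within r of x has x in its r-ball, and that ball stays within
     distance 2r < e of x. *)
  have [r /andP[r0 re]] : exists r : rat, (0 < ratr r :> R) && (ratr r < e / 2).
    have e20 : 0 < e / 2 by lra.
    by have [r] := @rat_in_itvoo R 0 (e / 2) e20; rewrite in_itv/=; exists r.
  have qi i : {q : rat | `|x ord0 i - ratr q| < ratr r}.
    apply: cid.
    have : (x ord0 i - ratr r < x ord0 i + ratr r :> R) by lra.
    move=> /rat_in_itvoo[q]; rewrite in_itv/= => /andP[q1 q2].
    by exists q; rewrite ltr_norml; apply/andP; split; lra.
  exists (\row_i sval (qi i), r).
    move=> y [_ /= By]; apply: xeA; split=> // i j.
    have := By i j; rewrite !mxE (ord1 i) /ball/= => Byj.
    have xq := svalP (qi j).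
    rewrite (_ : x _ _ - y _ _ = (x ord0 j - ratr (sval (qi j)))
                     + (ratr (sval (qi j)) - y ord0 j)); last by ring.
    rewrite (le_lt_trans (ler_normD _ _))//; lra.
  split=> // i j; rewrite !mxE (ord1 i) /ball/= distrC; exact: svalP (qi j).
rewrite bigcup_mkcond; apply: countable_bigcupT_measurable => // p.
by case: ifPn => // _; exact: measurable_ball_rV.
Qed.

Lemma closed_measurable_rV n (A : set 'rV[R]_n) : closed A -> measurable A.
Proof.
move=> /closed_openC/open_measurable_rV mA.
by rewrite -(setCK A); exact: measurableC.
Qed.

End open_measurable.

Section lebm.
Context {R : realType}.
Local Open Scope ereal_scope.

Definition consV n (p : R * 'rV[R]_n) : 'rV[R]_n.+1 := row_mx (\row_(_ < 1) p.1) p.2.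

Definition unconsV n (x : 'rV[R]_n.+1) : R * 'rV[R]_n := (x ord0 ord0, \row_i x ord0 (lift ord0 i)).

Lemma consVK n : cancel (@consV n) (@unconsV n).
Proof.
move=> [x v]; rewrite /unconsV /consV /=; congr pair.
  transitivity (row_mx (\row_(_ < 1) x) v ord0 (lshift n (ord0 : 'I_1))).
    by congr (fun_of_matrix _ _ _); exact/val_inj.
  by rewrite row_mxEl mxE.
apply/rowP => i; rewrite mxE.
transitivity (row_mx (\row_(_ < 1) x) v ord0 (rshift 1 i)).
  by congr (fun_of_matrix _ _ _); exact/val_inj.
by rewrite row_mxEr.
Qed.

Lemma unconsVK n : cancel (@unconsV n) (@consV n).
Proof.
move=> x; apply/rowP => i; rewrite /unconsV /consV /=.
rewrite mxE; case: fintype.splitP => j ij; rewrite mxE; congr (x _ _); apply/val_inj => /=.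
  by rewrite ij; case: j {ij} => -[].
by rewrite ij.
Qed.

Lemma measurable_consV n : measurable_fun setT (@consV n).
Proof.
apply: (@measurable_row_mxV _ _ _ 1 n (fun p => \row_(_ < 1) p.1) snd) => //.
exact: measurable_row1.
Qed.

Lemma measurable_unconsV n : measurable_fun setT (@unconsV n).
Proof.
apply/measurable_fun_pairP; split.
  exact: measurable_coord.
apply/measurable_fun_rVP => i /=.
by under eq_fun do rewrite mxE; exact: measurable_coord.
Qed.

Section step.
Variables (n : nat) (m : {sigma_finite_measure set 'rV[R]_n -> \bar R}).

Definition cons_measure : set 'rV[R]_n.+1 -> \bar R :=
  pushforward (@lebesgue_measure R \x m) (@consV n).

Let consm0 : cons_measure set0 = 0. Proof. by rewrite /cons_measure /pushforward preimage_set0 measure0. Qed.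
Let consm_ge0 A : 0 <= cons_measure A.
Proof. exact: (measure_ge0 (@lebesgue_measure R \x m)). Qed.
Let consm_sa : semi_sigma_additive cons_measure.
Proof.
move=> F mF tF mUF; rewrite /cons_measure /pushforward preimage_bigcup.
apply: measure_semi_sigma_additive.
- by move=> k; rewrite -[X in measurable X]setTI; exact: measurable_consV.
- apply/trivIsetP => i j Ti Tj ij; rewrite -preimage_setI.
  by move/trivIsetP : tF => /(_ i j Ti Tj ij) ->; rewrite preimage_set0.
- by rewrite -preimage_bigcup -[X in measurable X]setTI; exact: measurable_consV.
Qed.
HB.instance Definition _ := isMeasure.Build _ _ _ cons_measure consm0 consm_ge0 consm_sa.

Let consm_sf : sigma_finite setT cons_measure.
Proof.
have [F FT mF] : sigma_finite setT (@lebesgue_measure R \x m).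
  have /sigma_finiteP[F [TF ndF Foo]] := sigma_finiteT (@lebesgue_measure R).
  have /sigma_finiteP[G [TG ndG Goo]] := sigma_finiteT m.
  (* Both exhaustions increase, so a single index serves the two factors of the product. *)
  exists (fun k => F k `*` G k).
    rewrite -setXTT TF TG predeqE => -[x y]; split.
      move=> [/= [i _ Fix] [j _ Gjy]]; exists (maxn i j) => //; split.
      - by move: x Fix; exact/subsetPset/ndF/leq_maxl.
      - by move: y Gjy; exact/subsetPset/ndG/leq_maxr.
    by move=> [i _ []/= ? ?]; split; exists i.
  move=> i; have [? ?] := Foo i; have [? ?] := Goo i.
  split; first exact: measurableX.
  by rewrite product_measure1E// lte_mul_pinfty// ge0_fin_numE.
exists (fun i => @unconsV n @^-1` F i).
  by rewrite -preimage_bigcup -FT preimage_setT.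
move=> i; have [mFi Fi] := mF i; split.
  by rewrite -[X in measurable X]setTI; exact: measurable_unconsV.
rewrite /cons_measure /pushforward -comp_preimage (_ : _ \o _ = id)//.
by apply/funext => x /=; rewrite consVK.
Qed.
HB.instance Definition _ := Measure_isSigmaFinite.Build _ _ _ cons_measure consm_sf.

End step.

(** Same recursion as [lebint], with a point mass where [lebint] evaluates. Sigma-finiteness is part
    of the type because the next product and Tonelli both need it. *)
Fixpoint lebm (n : nat) : {sigma_finite_measure set 'rV[R]_n -> \bar R} :=
  match n with
  | 0 => (@dirac _ 'rV[R]_0 (0%R : 'rV[R]_0) R : {sigma_finite_measure set _ -> \bar R})
  | n'.+1 => (cons_measure (lebm n') : {sigma_finite_measure set _ -> \bar R})
  end.

End lebm.

Section lebm_theory.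
Context {R : realType}.
Local Notation mu1 := (@lebesgue_measure R).
Local Open Scope ereal_scope.

(** The bridge from the definitions to measure theory: Tonelli at each layer. The later work is done
    with [lebm]. *)
Lemma lebintE n (f : 'rV[R]_n -> \bar R) :
  measurable_fun setT f -> (forall x, 0 <= f x) ->
  lebint f = \int[lebm n]_x f x.
Proof.
elim: n f => [|n IHn] f mf f0 /=.
  by rewrite integral_dirac// diracT mul1e.
have mfc : measurable_fun setT (f \o @consV R n).
  by apply: measurableT_comp => //; exact: measurable_consV.
transitivity (\int[mu1]_x \int[lebm n]_v (f \o @consV R n) (x, v)).
  apply: eq_integral => x _; rewrite IHn//.
  exact: (measurableT_comp mfc (pair1_measurable x)).
transitivity (\int[mu1 \x lebm n]_p (f \o @consV R n) p).
  by rewrite fubini_tonelli1//= => p; exact: f0.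
by rewrite ge0_integral_pushforward//; exact: measurable_consV.
Qed.

Lemma lebm_consE n (f : 'rV[R]_n.+1 -> \bar R) :
  measurable_fun setT f -> (forall x, 0 <= f x) ->
  \int[lebm n.+1]_x f x =
    \int[mu1]_x \int[lebm n]_v f (row_mx (\row_(_ < 1) x) v).
Proof.
move=> mf f0; rewrite -lebintE//=; apply: eq_integral => x _.
rewrite lebintE//.
exact: (measurableT_comp (measurableT_comp mf (@measurable_consV R n)) (pair1_measurable x)).
Qed.

Lemma lebm_volE n (A : set 'rV[R]_n) : measurable A -> vol A = lebm n A.
Proof.
move=> mA; rewrite /vol lebintE ?integral_indic ?setIT//.
by apply/measurable_EFinP; exact: measurable_indic.
Qed.

(** The image of Lebesgue measure under x -> c x + h, multiplied by c, gives every half-open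
    interval its length, so by uniqueness it is Lebesgue measure. *)
Lemma integral_affine (c h : R) (f : R -> \bar R) : (0 < c)%R ->
  measurable_fun setT f -> (forall x, 0 <= f x) ->
  \int[mu1]_x f x = c%:E * \int[mu1]_x f (c * x + h)%R.
Proof.
move=> c0 mf f0.
pose phi (x : R) : measurableTypeR R := (c * x + h)%R.
have mphi : measurable_fun setT phi.
  by apply: measurable_funD => //; exact: measurable_funM.
pose m : {measure set (measurableTypeR R) -> \bar R} :=
  mscale (NngNum (ltW c0)) (pushforward mu1 phi).
have mE A : measurable A -> mu1 A = m mphi A.
  apply: lebesgue_measure_unique => X [[a b] _ <-] /=.
  rewrite /m/= /mscale/= /pushforward.
  have -> : (phi @^-1` `]a, b] = `](a - h) / c, (b - h) / c]%classic)%R.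
    apply/seteqP; split => x /=; rewrite !in_itv/= /phi.
      rewrite ltr_pdivrMr// ler_pdivlMr// => /andP[? ?]; apply/andP; split; lra.
    rewrite ltr_pdivrMr// ler_pdivlMr// => /andP[? ?]; apply/andP; split; lra.
  rewrite !lebesgue_measure_itv/= !lte_fin.
  rewrite ltr_pM2r ?invr_gt0// ltrD2r.
  case: ifPn => _; last by rewrite mule0.
  rewrite -!EFinD -EFinM; congr EFin.
  by field; rewrite gt_eqF.
transitivity (\int[m mphi]_x f x).
  by apply: eq_measure_integral => A mA _; exact: mE.
by rewrite /m ge0_integral_mscale//= ge0_integral_pushforward.
Qed.

(** The map acts separately on the first coordinate and on the remaining ones; each coordinate
    contributes one factor c. *)
Lemma lebm_affine n (c : R) (h : 'rV[R]_n) (f : 'rV[R]_n -> \bar R) : (0 < c)%R ->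
  measurable_fun setT f -> (forall x, 0 <= f x) ->
  \int[lebm n]_x f x = (c ^+ n)%:E * \int[lebm n]_x f (c *: x + h)%R.
Proof.
move=> c0; elim: n h f => [|n IHn] h f mf f0.
  rewrite /= expr0 mul1e !integral_dirac//; last first.
    apply: (measurableT_comp mf).
    by apply: measurable_addV => //; exact: measurable_scaleV.
  by congr (_ * f _); apply/rowP => -[].
set h0 := (unconsV h).1; set h1 := (unconsV h).2.
have hE x v : (c *: row_mx (\row_(_ < 1) x) v + h = row_mx (\row_(_ < 1) (c * x + h0)) (c *: v + h1))%R.
  rewrite -[h in LHS]unconsVK /consV scale_row_mx add_row_mx; congr row_mx.
  by apply/rowP => i; rewrite !mxE.
have mch : measurable_fun setT (fun x : 'rV[R]_n.+1 => f (c *: x + h)%R).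
  apply: (measurableT_comp mf).
  by apply: measurable_addV => //; exact: measurable_scaleV.
have mfc : measurable_fun setT (f \o @consV R n).
  by apply: measurableT_comp => //; exact: measurable_consV.
rewrite !lebm_consE//.
under [in RHS]eq_integral do under eq_integral do rewrite hE.
have mF : measurable_fun setT (fun x => \int[lebm n]_v f (row_mx (\row_(_ < 1) x) v)).
  by apply: (measurable_fun_fubini_tonelli_F (f \o @consV R n)) => // p; exact: f0.
have F0 x : 0 <= \int[lebm n]_v f (row_mx (\row_(_ < 1) x) v) by exact: integral_ge0.
rewrite (integral_affine h0 c0 mF F0).
rewrite exprS EFinM -muleA; congr (_ * _).
rewrite -ge0_integralZl//; last 3 first.
  apply: (measurable_fun_fubini_tonelli_F (fun p : R * 'rV[R]_n => f (row_mx (\row_(_ < 1) (c * p.1 + h0)) (c *: p.2 + h1))%R)) => //.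
  apply: (measurableT_comp mf); apply: (@measurable_row_mxV _ _ _ 1 n).
    by apply: measurable_row1; apply: measurable_funD => //; exact: measurable_funM.
  by apply: measurable_addV => //; exact: measurable_scaleV.
- by move=> x _; exact: integral_ge0.
- by rewrite lee_fin exprn_ge0// ltW.
apply: eq_integral => x _.
rewrite (IHn h1 (fun v => f (row_mx (\row_(_ < 1) (c * x + h0)%R) v)))//.
exact: (measurableT_comp mfc (pair1_measurable (c * x + h0)%R)).
Qed.

Lemma lebm_shift n (h : 'rV[R]_n) (f : 'rV[R]_n -> \bar R) :
  measurable_fun setT f -> (forall x, 0 <= f x) ->
  \int[lebm n]_x f (x + h)%R = \int[lebm n]_x f x.
Proof.
move=> mf f0; rewrite (@lebm_affine n 1 h f)// expr1n mul1e.
by under [RHS]eq_integral do rewrite scale1r.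
Qed.

End lebm_theory.

(** * Nonnegative measurable functions and Tonelli *)

Section nnm.
Context {R : realType}.
Local Open Scope ereal_scope.

(** Exactly what Tonelli asks for. Nonnegativity is required everywhere, not almost everywhere, so
    that the property survives composition and integration over a parameter. *)
Definition nnm d (T : measurableType d) (f : T -> \bar R) :=
  measurable_fun setT f /\ forall t, 0 <= f t.

Context d (T : measurableType d).

Lemma nnm_comp d' (T' : measurableType d') (f : T' -> \bar R) (g : T -> T') :
  nnm f -> measurable_fun setT g -> nnm (fun t => f (g t)).
Proof. by move=> [mf f0] mg; split => [|t]; [exact: (measurableT_comp mf)|exact: f0]. Qed.

Lemma nnm_cst (c : \bar R) : 0 <= c -> nnm (fun _ : T => c).
Proof. by move=> c0; split. Qed.

Lemma nnmM (f g : T -> \bar R) : nnm f -> nnm g -> nnm (fun t => f t * g t).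
Proof.
move=> [mf f0] [mg g0]; split; first exact: emeasurable_funM.
by move=> t; exact: mule_ge0.
Qed.

Lemma nnmD (f g : T -> \bar R) : nnm f -> nnm g -> nnm (fun t => f t + g t).
Proof.
move=> [mf f0] [mg g0]; split; first exact: emeasurable_funD.
by move=> t; exact: adde_ge0.
Qed.

Lemma nnm_EFin (f : T -> R) : measurable_fun setT f -> (forall t, 0 <= f t)%R ->
  nnm (fun t => (f t)%:E).
Proof. by move=> mf f0; split; [exact/measurable_EFinP|move=> t; rewrite lee_fin]. Qed.

Lemma nnm_bool (b : T -> bool) : measurable [set t | b t] ->
  nnm (fun t => (b t)%:R%:E).
Proof.
move=> mb; apply: nnm_EFin => [|t]; last by case: (b t).
rewrite (_ : (fun _ => _) = (\1_[set t | b t] : T -> R)); first exact: measurable_indic.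
by apply/funext => t; rewrite indicE; congr ((nat_of_bool _)%:R); apply/idP/idP; rewrite inE.
Qed.

Lemma nnm_indic d' (T' : measurableType d') (A : set T') (g : T -> T') :
  measurable A -> measurable_fun setT g -> nnm (fun t => (\1_A (g t))%:E).
Proof.
move=> mA mg; apply: (@nnm_comp _ T' (fun t => (\1_A t)%:E)) => //.
split=> [|t]; last by rewrite lee_fin.
by apply/measurable_EFinP; exact: measurable_indic.
Qed.

Lemma nnm_int d' (T' : measurableType d') (m : {sigma_finite_measure set T' -> \bar R})
   (f : T -> T' -> \bar R) :
  nnm (fun p : T * T' => f p.1 p.2) -> nnm (fun t => \int[m]_x f t x).
Proof.
move=> [mf f0]; split; last by move=> t; apply: integral_ge0 => x _; exact: (f0 (t, x)).
exact: (measurable_fun_fubini_tonelli_F (fun p : T * T' => f p.1 p.2)).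
Qed.

Lemma tonelli d' (T' : measurableType d') (m : {sigma_finite_measure set T -> \bar R})
  (m' : {sigma_finite_measure set T' -> \bar R}) (f : T -> T' -> \bar R) :
  nnm (fun p : T * T' => f p.1 p.2) ->
  \int[m]_t \int[m']_x f t x = \int[m']_x \int[m]_t f t x.
Proof. by move=> [mf f0]; exact: (fubini_tonelli (fun p : T * T' => f p.1 p.2)). Qed.

Lemma nnm_integralZl (m : {measure set T -> \bar R}) (c : \bar R) (f : T -> \bar R) :
  0 <= c -> nnm f -> \int[m]_t (c * f t) = c * \int[m]_t f t.
Proof. by move=> c0 [mf f0]; rewrite ge0_integralZl. Qed.

Lemma nnm_integralZr (m : {measure set T -> \bar R}) (c : \bar R) (f : T -> \bar R) :
  0 <= c -> nnm f -> \int[m]_t (f t * c) = \int[m]_t f t * c.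
Proof. by move=> c0 mf; rewrite muleC -nnm_integralZl//; apply: eq_integral => t _; rewrite muleC. Qed.

Lemma nnm_integralD (m : {measure set T -> \bar R}) (f g : T -> \bar R) :
  nnm f -> nnm g -> \int[m]_t (f t + g t) = \int[m]_t f t + \int[m]_t g t.
Proof. by move=> [mf f0] [mg g0]; rewrite ge0_integralD. Qed.

Lemma nnm_le_integral (m : {measure set T -> \bar R}) (f g : T -> \bar R) :
  nnm f -> nnm g -> (forall t, f t <= g t) -> \int[m]_t f t <= \int[m]_t g t.
Proof. by move=> [mf f0] [mg g0] fg; apply: ge0_le_integral => // t _; exact: fg. Qed.

Lemma integral_indicT (m : {measure set T -> \bar R}) (A : set T) : measurable A ->
  \int[m]_t (\1_A t)%:E = m A.
Proof. by move=> mA; rewrite integral_indic// setIT. Qed.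

End nnm.

(** * Euclidean norm and finite volumes *)

Section enorm.
Context {R : realType}.

Lemma enormE n (x : 'rV[R]_n) : enorm x = Num.sqrt ((x *m x^T) ord0 ord0).
Proof.
rewrite /enorm mxE; congr Num.sqrt; apply: eq_bigr => i _.
by rewrite mxE expr2.
Qed.

Lemma enorm_orth n (Q : 'M[R]_n) (x : 'rV[R]_n) : Q *m Q^T = 1%:M ->
  enorm (x *m Q) = enorm x.
Proof. by move=> QQ; rewrite !enormE trmx_mul mulmxA -(mulmxA x) QQ mulmx1. Qed.

Lemma enormN n (x : 'rV[R]_n) : enorm (- x) = enorm x.
Proof. by rewrite !enormE linearN/= mulmxN mulNmx opprK. Qed.

Lemma enormZ n (c : R) (x : 'rV[R]_n) : 0 <= c -> enorm (c *: x) = c * enorm x.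
Proof.
move=> c0; rewrite !enormE linearZ/= -scalemxAl -scalemxAr scalerA mxE.
by rewrite sqrtrM ?mulr_ge0// -expr2 sqrtr_sqr ger0_norm.
Qed.

Lemma enorm_ge0 n (x : 'rV[R]_n) : 0 <= enorm x.
Proof. exact: sqrtr_ge0. Qed.

Lemma le_coord_enorm n (x : 'rV[R]_n) i : `|x ord0 i| <= enorm x.
Proof.
rewrite -sqrtr_sqr /enorm ler_sqrt ?sumr_ge0//; last by move=> j _; exact: sqr_ge0.
by rewrite (bigD1 i)//= lerDl sumr_ge0// => j _; exact: sqr_ge0.
Qed.

Lemma measurable_enorm d (T : measurableType d) n (f : T -> 'rV[R]_n) :
  measurable_fun setT f -> measurable_fun setT (fun t => enorm (f t)).
Proof.
move=> mf; have ms : measurable_fun setT (Num.sqrt : R -> R).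
  by apply: continuous_measurable_fun; exact: sqrt_continuous.
have mS : measurable_fun setT (fun t => \sum_(i < n) f t ord0 i ^+ 2).
  by apply: measurable_sum => i; apply: measurable_funX; exact: measurable_coord.
exact: (measurableT_comp ms mS).
Qed.

Lemma measurable_enorm_le d (T : measurableType d) n (f : T -> 'rV[R]_n) (r : R) :
  measurable_fun setT f -> measurable [set t | enorm (f t) <= r].
Proof.
move=> /measurable_enorm/(_ measurableT `]-oo, r]%classic) /(_ (measurable_itv _)).
by rewrite setTI; congr measurable.
Qed.

End enorm.

Section lebm_finite.
Context {R : realType}.
Local Open Scope ereal_scope.

Definition box n (a : R) : set 'rV[R]_n := [set x | forall i, `|x ord0 i| <= a]%R.

Lemma measurable_box n a : measurable (@box n a).
Proof.
rewrite (_ : box a = \bigcap_(i in [set: 'I_n]) [set x : 'rV[R]_n | `|x ord0 i| <= a]%R).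
  apply: fin_bigcap_measurable => // i _.
  have : measurable_fun setT (fun x : 'rV[R]_n => `|x ord0 i|%R).
    by apply: measurableT_comp => //; exact: measurable_coord.
  move=> /(_ measurableT `]-oo, a]%classic (measurable_itv _)).
  by rewrite setTI; congr measurable.
by apply/seteqP; split => [x xa i _|x xa i]; exact: xa.
Qed.

Lemma lebm_box n a : (0 <= a)%R -> lebm n (@box n a) = ((2 * a) ^+ n)%:E.
Proof.
move=> a0; elim: n => [|n IHn].
  by rewrite /= diracE expr0 mem_set//= => -[].
rewrite -integral_indicT; last exact: measurable_box.
have [mf f0] : nnm (fun x => (\1_(@box n.+1 a) x)%:E : \bar R).
  by apply: nnm_indic => //; exact: measurable_box.
rewrite lebm_consE//.
transitivity (\int[@lebesgue_measure R]_x ((\1_`[(- a)%R, a]%classic x)%:E * ((2 * a) ^+ n)%:E)).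
  apply: eq_integral => x _; rewrite -IHn -integral_indicT; last exact: measurable_box.
  rewrite -nnm_integralZl; [|by rewrite lee_fin|by apply: nnm_indic => //; exact: measurable_box].
  apply: eq_integral => v _; rewrite -EFinM !indicE -natrM mulnb; congr ((nat_of_bool _)%:R%:E).
  apply/idP/andP.
    rewrite inE => b; split.
      rewrite inE/= in_itv/= -ler_norml.
      have e1 : row_mx (\row_(_ < 1) x) v ord0 (lshift n (ord0 : 'I_1)) = x.
        by rewrite row_mxEl mxE.
      by rewrite -[X in `|X|%R]e1; exact: b.
    rewrite inE => i.
    by rewrite -(row_mxEr (\row_(_ < 1) x) v); exact: b.
  rewrite !inE/= in_itv/= -ler_norml => -[xa va] i.
  rewrite mxE; case: fintype.splitP => j _; last exact: va.
  by rewrite mxE.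
rewrite nnm_integralZr; [|by rewrite lee_fin exprn_ge0// mulr_ge0|by apply: nnm_indic].
rewrite integral_indicT//= lebesgue_measure_itv/= lte_fin.
rewrite exprS EFinM; congr (_ * _).
case: ltP => aa; first by rewrite -EFinD; congr EFin; ring.
by congr EFin; lra.
Qed.

(** The maximum with 0 allows a negative M, as may occur for an empty set. *)
Lemma lebm_bounded n (A : set 'rV[R]_n) M : measurable A -> A `<=` box M ->
  lebm n A <= ((2 * Num.max 0 M) ^+ n)%:E.
Proof.
move=> mA AM; rewrite -lebm_box ?le_max ?lexx//.
apply: le_measure; rewrite ?inE//; first exact: measurable_box.
by move=> x /AM xM i; rewrite le_max xM orbT.
Qed.

Definition uball n : set 'rV[R]_n := [set x | enorm x <= 1]%R.

Lemma measurable_uball n : measurable (@uball n).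
Proof. exact: (@measurable_enorm_le _ _ _ n id). Qed.

Lemma lebm_uball_lty n : lebm n (@uball n) < +oo.
Proof.
apply: (le_lt_trans (lebm_bounded (@measurable_uball n) (_ : _ `<=` box 1%R))).
  by move=> x x1 i; exact: le_trans (le_coord_enorm x i) x1.
exact: ltry.
Qed.

Lemma lebm_uball_gt0 n : 0 < lebm n (@uball n).
Proof.
(* A box of half-side 1 / (n + 1) fits into the unit ball: each squared coordinate is at most 1 / (n
   + 1), so their sum is at most n / (n + 1). Using n + 1 also covers dimension 0. *)
apply: (@lt_le_trans _ _ (lebm n (@box n (n.+1%:R^-1)%R))).
  rewrite lebm_box// lte_fin exprn_gt0// mulr_gt0//.
apply: le_measure; rewrite ?inE; [exact: measurable_box|exact: measurable_uball|].
move=> x xb; rewrite /uball/= /enorm -(@sqrtr1 R) ler_sqrt//.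
apply: (@le_trans _ _ (\sum_(i < n) n.+1%:R^-1)%R).
  apply: ler_sum => i _; rewrite -real_normK ?num_real//.
  have xi := xb i.
  rewrite expr2 (le_trans (ler_pM _ _ xi xi))// ler_piMl//.
  by rewrite invf_le1// ler1n.
by rewrite sumr_const card_ord -[leLHS]mulr_natl ler_pdivrMr// mul1r ler_nat.
Qed.

End lebm_finite.

Section lebm_orth.
Context {R : realType}.
Local Open Scope ereal_scope.

(* Both sides are translation invariant in g; integrating f(x) g(yQ) over x and y, with f
   the indicator of the unit ball, identifies the proportionality constant. *)
Lemma lebm_orth n (Q : 'M[R]_n) (g : 'rV[R]_n -> \bar R) : Q *m Q^T = 1%:M -> nnm g ->
  \int[lebm n]_x g (x *m Q) = \int[lebm n]_x g x.
Proof.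
move=> QQ mg; have QQ' : Q^T *m Q = 1%:M by exact: mulmx1C.
pose f (x : 'rV[R]_n) : \bar R := (\1_(@uball R n) x)%:E.
have fgt x : 0 <= f x by rewrite lee_fin.
have ggt x : 0 <= g x by case: mg => _; exact.
have mf : nnm f by apply: nnm_indic => //; exact: measurable_uball.
have If : \int[lebm n]_x f x = lebm n (@uball R n) by rewrite integral_indicT//; exact: measurable_uball.
have m1 : measurable_fun setT (fst : 'rV[R]_n * 'rV[R]_n -> _) by [].
have m2 : measurable_fun setT (snd : 'rV[R]_n * 'rV[R]_n -> _) by [].
have mgQ : nnm (fun x => g (x *m Q)).
  by apply: nnm_comp => //; exact: measurable_mulmxV.
have : (\int[lebm n]_x f x) * \int[lebm n]_x g (x *m Q)
     = (\int[lebm n]_x f x) * \int[lebm n]_x g x.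
  rewrite -nnm_integralZr//; last by apply: integral_ge0.
  transitivity (\int[lebm n]_x \int[lebm n]_y (f x * g (y *m Q + x)%R)).
    apply: eq_integral => x _; rewrite -(nnm_integralZl _ (fgt x) mgQ).
    rewrite -[LHS](lebm_shift (x *m Q^T)).
    - by apply: eq_integral => y _; rewrite mulmxDl -mulmxA QQ' mulmx1.
    - by case: (nnmM (nnm_cst _ (fgt x)) mgQ).
    - by move=> y; rewrite mule_ge0.
  rewrite tonelli; last first.
    apply: nnmM; first exact: nnm_comp.
    by apply: nnm_comp => //; apply: measurable_addV => //; exact: measurable_mulmxV.
  transitivity (\int[lebm n]_y \int[lebm n]_x (f (x - y *m Q)%R * g x)).
    apply: eq_integral => y _.
    rewrite -[LHS](lebm_shift (- (y *m Q))%R).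
    - by apply: eq_integral => x _; rewrite (addrC (y *m Q)) subrK.
    - have : nnm (fun x => f x * g (y *m Q + x)%R); last by case.
      apply: nnmM => //; apply: nnm_comp => //; exact: measurable_addV.
    - by move=> x; rewrite mule_ge0.
  rewrite tonelli; last first.
    apply: nnmM; last exact: nnm_comp.
    by apply: nnm_comp => //; apply: measurable_addV => //; apply: measurable_oppV;
      exact: measurable_mulmxV.
  rewrite -nnm_integralZl//; last by apply: integral_ge0.
  apply: eq_integral => x _; rewrite nnm_integralZr//; last first.
    apply: nnm_comp => //; apply: measurable_addV => //; apply: measurable_oppV.
    exact: measurable_mulmxV.
  congr (_ * _).
  rewrite -[RHS](lebm_shift (- (x *m Q^T))%R); [|by case: mf|by []].
  apply: eq_integral => y _; rewrite /f !indicE; congr ((nat_of_bool _)%:R%:E).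
  (* The unit ball is symmetric and invariant under Q, which lets the roles of x and y be
     exchanged. *)
  have e : enorm (x - y *m Q) = enorm (y - x *m Q^T).
    rewrite -(enorm_orth (y - _) QQ) mulmxBl -mulmxA QQ' mulmx1 -enormN opprB//.
  by apply/idP/idP; rewrite !inE /uball/= e.
rewrite If => e.
have fn : lebm n (@uball R n) \is a fin_num.
  by rewrite ge0_fin_numE// lebm_uball_lty.
have n0 : fine (lebm n (@uball R n)) != 0%R.
  by rewrite gt_eqF// fine_gt0// lebm_uball_gt0 lebm_uball_lty.
rewrite -[LHS]mul1e -[RHS]mul1e.
rewrite (_ : 1 = (fine (lebm n (@uball R n)))^-1%:E * lebm n (@uball R n)).
  by rewrite -!muleA e.
by rewrite -[X in _ * X]fineK// -EFinM mulVf.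
Qed.

(** Two coordinates are peeled off on either side; what then remains of [lebm 2] is the point mass
    at the empty row. *)
Lemma lebm_split k (f : 'rV[R]_(k.+2) -> \bar R) : nnm f ->
  \int[lebm k.+2]_x f x = \int[lebm 2]_u \int[lebm k]_w f (row_mx u w : 'rV[R]_(2 + k)).
Proof.
move=> nf; have [mf f0] := nf.
pose G (u : 'rV[R]_2) := \int[lebm k]_w f (row_mx u w : 'rV[R]_(2 + k)).
have nG : nnm G.
  apply: nnm_int; apply: nnm_comp nf _; exact: (@measurable_row_mxV _ _ _ 2 k fst snd).
have [mG G0] := nG.
rewrite lebm_consE// [RHS]lebm_consE//.
apply: eq_integral => x _.
have mx1 m : measurable_fun setT (fun v : 'rV[R]_m => row_mx (\row_(_ < 1) x) v : 'rV[R]_m.+1).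
  exact: (@measurable_row_mxV _ _ _ 1 m (fun _ => \row_(_ < 1) x) id).
have m1f := measurableT_comp mf (mx1 k.+1).
have m1G := measurableT_comp mG (mx1 1%N).
apply: etrans (lebm_consE m1f _) _; first by move=> v; exact: f0.
apply/esym; apply: etrans (lebm_consE m1G _) _; first by move=> v; exact: G0.
apply/esym; apply: eq_integral => y _ /=.
rewrite integral_dirac//; last first.
  apply: (measurableT_comp m1G).
  exact: (@measurable_row_mxV _ _ _ 1 0 (fun _ => \row_(_ < 1) y) id).
rewrite diracT mul1e /G /=; apply: eq_integral => w _; congr f.
have -> : row_mx (\row_(_ < 1) y) (0 : 'rV[R]_0) = (\row_(_ < 1) y : 'rV[R]_(1 + 0)).
  by apply/rowP => i; rewrite !mxE; case: fintype.splitP => -[]//= j ?; rewrite mxE.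
have /= := @row_mxA _ _ _ _ _ (\row_(_ < 1) x) (\row_(_ < 1) y) w.
by move: (esym _) => e ->; exact: (castmx_id (erefl, e : k.+2 = k.+2)).
Qed.

End lebm_orth.

(** * Crossing segments *)

Section crossing.
Context {R : realType}.

Definition segments_meet n (p1 p2 p3 p4 : 'rV[R]_n) : Prop :=
  segment p1 p2 `&` segment p3 p4 !=set0.

(** Crossing becomes the vanishing of a function continuous in (a, b), the form needed for the
    compactness argument. *)
Lemma segments_meetP n (p1 p2 p3 p4 : 'rV[R]_n) : segments_meet p1 p2 p3 p4 <->
  exists a b : R, [/\ 0 <= a <= 1, 0 <= b <= 1 &
    (1 - a) *: p1 + a *: p2 - ((1 - b) *: p3 + b *: p4) = 0].
Proof.
split.
  move=> [q [[a /=]]]; rewrite in_itv/= => a01 <- [b /=]; rewrite in_itv/= => b01 e.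
  by exists a, b; split=> //; rewrite e subrr.
move=> [a [b [a01 b01 /eqP]]]; rewrite subr_eq0 => /eqP e.
exists ((1 - a) *: p1 + a *: p2); split; first by exists a => //=; rewrite in_itv.
by exists b => //=; rewrite in_itv.
Qed.

Lemma segments_meet_affine n (c : R) (h p1 p2 p3 p4 : 'rV[R]_n) : c != 0 ->
  segments_meet (h + c *: p1) (h + c *: p2) (h + c *: p3) (h + c *: p4) <-> segments_meet p1 p2 p3 p4.
Proof.
move=> c0.
have e a b : (1 - a) *: (h + c *: p1) + a *: (h + c *: p2) -
   ((1 - b) *: (h + c *: p3) + b *: (h + c *: p4)) =
   c *: ((1 - a) *: p1 + a *: p2 - ((1 - b) *: p3 + b *: p4)).
  by apply/rowP => i; rewrite !mxE; ring.
split=> /segments_meetP[a [b [a01 b01]]].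
  rewrite e => /eqP; rewrite scaler_eq0 (negbTE c0)/= => /eqP ab.
  by apply/segments_meetP; exists a, b.
by move=> ab; apply/segments_meetP; exists a, b; split=> //; rewrite e ab scaler0.
Qed.

Lemma segment_lin m n (M : 'M[R]_(m, n)) (a b : 'rV[R]_m) :
  (fun x => x *m M) @` segment a b = segment (a *m M) (b *m M).
Proof.
apply/seteqP; split => x /=.
  move=> [_ [s s01 <-] <-]; exists s => //.
  by rewrite mulmxDl -!scalemxAl.
move=> [s s01 <-]; exists ((1 - s) *: a + s *: b); first by exists s.
by rewrite mulmxDl -!scalemxAl.
Qed.

(** Retraction of the line onto [0, 1]: a rational close to a parameter in [0, 1] may fall outside
    the interval, and clamping makes it admissible again. *)
Let clamp (r : R) : R := Num.max 0 (Num.min 1 r).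

Let clamp01 r : 0 <= clamp r <= 1.
Proof. by rewrite /clamp le_max lexx/= ge_max ler01 ge_min lexx. Qed.

Let clampE r : 0 <= r <= 1 -> clamp r = r.
Proof. by move=> /andP[r0 r1]; rewrite /clamp min_r// max_r. Qed.

Let clamp_cont : continuous clamp.
Proof.
move=> x.
have h : {for x, continuous ((fun=> 0 : R^o) \max ((fun=> 1 : R^o) \min (id : R^o -> R^o)))}.
  apply: continuous_max; first exact: cvg_cst.
  by apply: continuous_min; [exact: cvg_cst|exact: cvg_id].
exact: h.
Qed.

(* Compactness of the parameter square turns the existential over real parameters into a
   countable intersection of countable unions over rational ones. *)
Lemma measurable_segments_meet d (T : measurableType d) n (P1 P2 P3 P4 : T -> 'rV[R]_n.+1) :
  measurable_fun setT P1 -> measurable_fun setT P2 ->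
  measurable_fun setT P3 -> measurable_fun setT P4 ->
  measurable [set t | segments_meet (P1 t) (P2 t) (P3 t) (P4 t)].
Proof.
move=> m1 m2 m3 m4.
pose g t (p : R * R) := (1 - p.1) *: P1 t + p.1 *: P2 t - ((1 - p.2) *: P3 t + p.2 *: P4 t).
have gcont t : continuous (g t).
  move=> p; rewrite /g; apply: cvgB; apply: cvgD; apply: cvgZr_tmp.
  - by apply: cvgB; [exact: cvg_cst|exact: cvg_fst].
  - exact: cvg_fst.
  - by apply: cvgB; [exact: cvg_cst|exact: cvg_snd].
  - exact: cvg_snd.
pose N t (p : R * R) := `|g t (clamp p.1, clamp p.2)|.
have clc : continuous (fun p : R * R => (clamp p.1, clamp p.2)).
  move=> p; apply: (@cvg_pair _ _ _ _ (nbhs (clamp p.1)) (nbhs (clamp p.2))) => /=.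
    exact: (@continuous_comp _ _ _ fst clamp p cvg_fst (@clamp_cont p.1)).
  exact: (@continuous_comp _ _ _ snd clamp p cvg_snd (@clamp_cont p.2)).
have Ncont t : continuous (N t).
  move=> p; have := @continuous_comp _ _ _ _ (g t) p (clc p) (gcont t _).
  move=> /continuous_comp; apply; exact: norm_continuous.
rewrite (_ : [set t | _] = \bigcap_m \bigcup_(p in [set: rat * rat])
    [set t | N t (ratr p.1, ratr p.2) < m.+1%:R^-1]); last first.
  apply/seteqP; split => t /=.
    move=> /segments_meetP[a [b [a01 b01 e]]] m _.
    have N0 : N t (a, b) = 0.
      by rewrite /N /g /= !clampE// e normr0.
    have : \forall p \near (a, b), N t p < m.+1%:R^-1.
      have : N t (a, b) < m.+1%:R^-1 by rewrite N0 invr_gt0.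
      by move=> /lt_nbhsl /(Ncont t (a, b)).
    move=> /nbhs_ballP[e' /= e'0 ab].
    have rr c : {q : rat | ball c e' (ratr q : R)}.
      apply: cid.
      have : (c - e' < c + e' :> R) by lra.
      move=> /rat_in_itvoo[q]; rewrite in_itv/= => /andP[q1 q2].
      by exists q; rewrite /ball/= ltr_norml; apply/andP; split; lra.
    exists (sval (rr a), sval (rr b)) => //=.
    have abq : ball (a, b) e' (ratr (sval (rr a)) : R, ratr (sval (rr b)) : R).
      by split; [exact: (svalP (rr a))|exact: (svalP (rr b))].
    exact: (ab _ abq).
  move=> tN.
  (* The values on the square form a compact, hence closed, set. The rational parameters give values
     arbitrarily close to 0, so 0 is attained and the segments really meet. *)
  pose K := N t @` (`[0, 1] `*` `[0, 1]).
  have cK : closed K.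
    apply: compact_closed; first exact: norm_hausdorff.
    apply: continuous_compact; last by apply: compact_setX; exact: segment_compact.
    exact: continuous_subspaceT.
  have : K 0.
    rewrite (closure_id K).1//= => U /nbhs_ballP[e /= e0 U0].
    have [m me] : exists m, m.+1%:R^-1 < e.
      have [m _ /(_ m (leqnn m)) me] := near_infty_natSinv_lt (PosNum e0).
      by exists m.
    have [[p q] _ /= pq] := tN m I.
    exists (N t (ratr p, ratr q)); split.
      exists (clamp (ratr p), clamp (ratr q)).
        by split; rewrite /= in_itv/=; exact: clamp01.
      by rewrite /N/= (clampE (clamp01 _)) (clampE (clamp01 _)).
    by apply: U0; rewrite /ball/= sub0r normrN ger0_norm ?normr_ge0// (lt_trans pq).
  move=> [[a b] [/= a01 b01] /eqP]; rewrite normr_eq0 /g/= !in_itv/= in a01 b01 *.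
  rewrite !clampE// => /eqP e.
  by apply/segments_meetP; exists a, b.
apply: bigcapT_measurable => m.
apply: countable_bigcupT_measurable => // p.
rewrite (_ : [set t | _] = (fun t => g t (clamp (ratr p.1), clamp (ratr p.2))) @^-1` ball 0 m.+1%:R^-1).
  rewrite -[X in measurable X]setTI.
  have mg : measurable_fun setT (fun t => g t (clamp (ratr p.1), clamp (ratr p.2))).
    by apply: measurable_addV; [|apply: measurable_oppV];
      apply: measurable_addV; exact: measurable_scaleV.
  by apply: mg => //; exact: measurable_ball_rV.
apply/seteqP; split => t /=; by rewrite /N mx_norm_ball /ball_ /= sub0r normrN.
Qed.

End crossing.

(** * Sums over independent points and Poisson moments *)

Section iid_points.
Context {R : realType} (k : nat) (W : set 'rV[R]_(k.+2)).
Hypothesis mW : measurable W.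
Hypothesis W1 : lebm k.+2 W = 1%E.
Local Notation V := 'rV[R]_(k.+2).
Local Open Scope ereal_scope.

Definition EW (g : V -> \bar R) : \bar R := \int[lebm k.+2]_x ((\1_W x)%:E * g x).

Let nW d (T : measurableType d) (X : T -> V) : measurable_fun setT X ->
  nnm (fun t => (\1_W (X t))%:E : \bar R).
Proof. by move=> mX; exact: nnm_indic. Qed.

Lemma EW_ge0 g : (forall x, 0 <= g x) -> 0 <= EW g.
Proof. by move=> g0; apply: integral_ge0 => x _; rewrite mule_ge0// lee_fin. Qed.

Lemma nnm_EW d (T : measurableType d) (f : T -> V -> \bar R) :
  nnm (fun p : T * V => f p.1 p.2) -> nnm (fun t => EW (f t)).
Proof. by move=> mf; apply: nnm_int; apply: nnmM => //; exact: nW. Qed.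

Lemma EW_swap (f : V -> V -> \bar R) : nnm (fun p : V * V => f p.1 p.2) ->
  EW (fun x => EW (fun y => f x y)) = EW (fun y => EW (fun x => f x y)).
Proof.
move=> mf; have f0 x y : 0 <= f x y by case: mf => _ /(_ (x, y)).
have m1f x : nnm (f x) by apply: (nnm_comp mf (pair1_measurable x)).
have m2f y : nnm (f ^~ y) by apply: (nnm_comp mf (pair2_measurable y)).
transitivity (\int[lebm k.+2]_x \int[lebm k.+2]_y ((\1_W x)%:E * ((\1_W y)%:E * f x y))).
  apply: eq_integral => x _; rewrite -nnm_integralZl ?lee_fin//.
  by apply: nnmM => //; exact: nW.
rewrite tonelli; last first.
  by apply: nnmM; [exact: nW|apply: nnmM => //; exact: nW].
apply: eq_integral => y _; rewrite -nnm_integralZl ?lee_fin//; last first.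
  by apply: nnmM => //; exact: nW.
by apply: eq_integral => x _; rewrite muleCA.
Qed.

Lemma EW_cst c : 0 <= c -> EW (fun _ => c) = c.
Proof.
move=> c0; have e : \int[lebm k.+2]_x (\1_W x)%:E = 1 :> \bar R.
  by rewrite -W1; exact: integral_indicT.
by rewrite /EW nnm_integralZr//; [rewrite e mul1e|exact: nW].
Qed.

Fixpoint all_measurable d (T : measurableType d) (Xs : seq (T -> V)) : Prop :=
  if Xs is X :: Xs' then measurable_fun setT X /\ all_measurable Xs' else True.

Lemma all_measurable_cat d (T : measurableType d) (Xs Ys : seq (T -> V)) :
  all_measurable (Xs ++ Ys) <-> all_measurable Xs /\ all_measurable Ys.
Proof.
elim: Xs => /= [|X Xs IH]; first by split=> [|[]].
by split=> [[mX /IH[]]|[[mX mXs] mYs]]; repeat split => //; exact/IH.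
Qed.

Lemma all_measurable_nth d (T : measurableType d) (Xs : seq (T -> V)) i : all_measurable Xs ->
  measurable_fun setT (nth (fun _ => 0%R) Xs i).
Proof. by elim: Xs i => [|X Xs IH] [|i] //= [mX mXs] //; exact: IH. Qed.

Lemma all_measurable_cst d (T : measurableType d) (s : seq V) : all_measurable [seq (fun _ : T => v) | v <- s].
Proof. by elim: s => //= v s IH; split. Qed.

Lemma all_measurable_comp d d' (T : measurableType d) (T' : measurableType d') (g : T' -> T) Xs :
  measurable_fun setT g -> all_measurable Xs -> all_measurable [seq X \o g | X <- Xs].
Proof.
move=> mg; elim: Xs => //= X Xs IH [mX mXs]; split; last exact: IH.
exact: measurableT_comp.
Qed.

(** Joint measurability of a functional of lists, expressed without a sigma-algebra on lists: it is
    tested on all finite lists of measurable maps from an arbitrary space. *)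
Definition seq_nnm (h : seq V -> \bar R) := (forall s, 0 <= h s) /\
  forall d (T : measurableType d) (Xs : seq (T -> V)), all_measurable Xs ->
    measurable_fun setT (fun t => h [seq X t | X <- Xs]).

Lemma seq_nnm_nnm h d (T : measurableType d) (Xs : seq (T -> V)) (f : T -> seq V) :
  seq_nnm h -> all_measurable Xs -> (forall t, f t = [seq X t | X <- Xs]) -> nnm (fun t => h (f t)).
Proof.
move=> [h0 mh] mXs fE; rewrite (_ : f = fun t => [seq X t | X <- Xs]); last exact/funext.
by split => //; exact: mh.
Qed.

(** The prefix s is what makes the induction work: each integrated point is appended to it, and
    Tonelli gives measurability in what remains. *)
Lemma seq_nnm_unifE n h : seq_nnm h -> seq_nnm (fun s => unifE W n (fun r => h (s ++ r))).
Proof.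
elim: n h => [|n IHn] h mh.
  by rewrite (_ : (fun s => _) = h)//; apply/funext => s /=; rewrite cats0.
have m1 := IHn _ mh.
set h1 := (fun s => unifE W n (fun r => h (s ++ r))) in m1.
have mj d (T : measurableType d) (Xs : seq (T -> V)) : all_measurable Xs ->
    nnm (fun p : T * V => h1 (rcons [seq X p.1 | X <- Xs] p.2)).
  move=> mXs; apply: (seq_nnm_nnm (Xs := rcons [seq X \o fst | X <- Xs] snd) m1).
    by rewrite -cats1; apply/all_measurable_cat; split => //; exact: all_measurable_comp.
  by move=> p; rewrite map_rcons -map_comp.
have m1s s : nnm (fun x => h1 (rcons s x)).
  apply: (seq_nnm_nnm (Xs := rcons [seq (fun _ => v) | v <- s] id) m1).
    by rewrite -cats1; apply/all_measurable_cat; split => //; exact: all_measurable_cst.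
  by move=> x; rewrite map_rcons -map_comp map_id.
have E s : unifE W n.+1 (fun r => h (s ++ r)) = EW (fun x => h1 (rcons s x)).
  transitivity (lebint (fun x => (\1_W x)%:E * unifE W n (fun r => h (s ++ x :: r)))).
    by [].
  rewrite /EW -lebintE; last 2 first.
  - by apply: (proj1 (nnmM _ (m1s s))); exact: nW.
  - by apply: (proj2 (nnmM _ (m1s s))); exact: nW.
  congr (@lebint R k.+2 _); apply/funext => x; congr (_ * _).
  by rewrite /h1; congr (unifE W n _); apply/funext => r; rewrite cat_rcons.
split=> [s|d T Xs mXs]; first by rewrite E; apply: EW_ge0 => x; apply: (m1s s).2.
under eq_fun do rewrite E.
by apply: (proj1 (nnm_EW _)); exact: mj.
Qed.

Lemma seq_nnm_cons h x : seq_nnm h -> seq_nnm (fun s => h (x :: s)).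
Proof.
move=> [h0 mh]; split => // d T Xs mXs.
by apply: (mh _ _ ((fun _ => x) :: Xs)); split.
Qed.

Lemma unifE_S n h : seq_nnm h ->
  unifE W n.+1 h = EW (fun x => unifE W n (fun r => h (x :: r))).
Proof.
move=> mh; have mu := seq_nnm_unifE n mh.
have nu : nnm (fun x => (\1_W x)%:E * unifE W n (fun r => h (x :: r))).
  apply: nnmM; first exact: nW.
  exact: (seq_nnm_nnm (Xs := [:: id]) (f := fun x => [:: x]) mu).
transitivity (lebint (fun x => (\1_W x)%:E * unifE W n (fun r => h (x :: r)))) => //.
by case: nu => nu1 nu2; rewrite lebintE.
Qed.

Lemma unifE_ge0 n h : seq_nnm h -> 0 <= unifE W n h.
Proof. by move=> /(seq_nnm_unifE n)[/(_ [::])]. Qed.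

(** Moves the head of the list to position j. *)
Definition insert_at (A : Type) (j : nat) (s : seq A) : seq A :=
  if s is x :: r then take j r ++ x :: drop j r else s.

Lemma map_insert_at (A B : Type) (f : A -> B) j s : map f (insert_at j s) = insert_at j (map f s).
Proof. by case: s => //= x s; rewrite map_cat/= map_take map_drop. Qed.

Lemma seq_nnm_insert h j : seq_nnm h -> seq_nnm (fun s => h (insert_at j s)).
Proof.
move=> [h0 mh]; split=> // d T Xs mXs.
under eq_fun do rewrite -map_insert_at.
apply: mh; case: Xs mXs => //= X Xs [mX mXs].
by move: mXs; rewrite -{1}(cat_take_drop j Xs) => /all_measurable_cat[? ?]; apply/all_measurable_cat.
Qed.

(** Exchangeability of the sample: the integrals over the first two points are swapped, and the old
    head then travels on inside the tail by induction. *)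
Lemma unifE_insert_at m j h : (j <= m)%N -> seq_nnm h ->
  unifE W m.+1 (fun s => h (insert_at j s)) = unifE W m.+1 h.
Proof.
elim: j m h => [|j IHj] m h jm mh.
  by congr (unifE W _ _); apply/funext => -[|x s]//=; rewrite take0 drop0.
case: m jm => [|m] jm; first by rewrite ltn0 in jm.
have mhi := seq_nnm_insert j.+1 mh.
rewrite (unifE_S _ mhi) (unifE_S _ mh).
transitivity (EW (fun x => EW (fun y => unifE W m (fun r => h (y :: insert_at j (x :: r)))))).
  rewrite /EW; apply: eq_integral => x _; congr (_ * _).
  by rewrite unifE_S//; exact: (seq_nnm_cons x mhi).
rewrite EW_swap; last first.
  apply: (seq_nnm_nnm (Xs := [:: fst; snd]) (f := fun p => [:: p.1; p.2]) (seq_nnm_unifE m mhi)).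
    by [].
  by move=> p.
rewrite /EW; apply: eq_integral => y _; congr (_ * _).
have my := seq_nnm_cons y mh.
by rewrite -(IHj m _ jm my) (unifE_S _ (seq_nnm_insert j my)).
Qed.

Lemma seq_nnm_nth h l : seq_nnm h -> seq_nnm (fun s => h [seq nth 0%R s i | i <- l]).
Proof.
move=> [h0 mh]; split=> // d T Xs mXs.
rewrite (_ : (fun t => _) = (fun t => h [seq Y t | Y <- [seq nth (fun _ => 0%R) Xs i | i <- l]])).
  by apply: mh; elim: l => //= i l IH; split=> //; exact: all_measurable_nth.
apply/funext => t; congr h; rewrite -map_comp; apply: eq_map => i /=.
by elim: Xs i {mXs} => [|X Xs IH] [|i]//=.
Qed.

(** Points picked at distinct positions of an i.i.d. sample are again i.i.d. Induction on n by
    integrating out the first point: if its position is not selected, it contributes total mass 1;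
    otherwise exchangeability brings its slot to the front. *)
Lemma unifE_select n l h : uniq l -> all (fun i => i < n)%N l -> seq_nnm h ->
  unifE W n (fun s => h [seq nth 0%R s i | i <- l]) = unifE W (size l) h.
Proof.
elim: n l h => [|n IHn] l h ul ln mh; first by case: l ul ln.
rewrite unifE_S; last exact: seq_nnm_nth.
(* Once the first point is removed, the selected positions, none of which is 0, go down by one. *)
have shift l' : 0%N \notin l' -> uniq l' -> all (fun i => i < n.+1)%N l' ->
    [/\ uniq (map predn l'), all (fun i => i < n)%N (map predn l') &
     forall x s, [seq nth 0%R (x :: s) i | i <- l'] = [seq nth (0%R : V) s i | i <- map predn l']].
  move=> l0 ul' ln'; split.
  - rewrite map_inj_in_uniq// => -[|i] [|j] il jl //=; last by move->.
    + by move=> _; rewrite (negPf l0) in il.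
    + by move=> _; rewrite (negPf l0) in jl.
  - apply/allP => _ /mapP[[|i] il ->]; first by rewrite (negPf l0) in il.
    by move/allP : ln' => /(_ _ il).
  - move=> x s; rewrite -map_comp; apply/eq_in_map => -[|i] //= il.
    by rewrite (negPf l0) in il.
case: (boolP (0%N \in l)) => l0; last first.
  have [u a e] := shift _ l0 ul ln.
  rewrite -[RHS]EW_cst ?unifE_ge0// /EW; apply: eq_integral => x _; congr (_ * _).
  under [in LHS]eq_fun do rewrite e.
  by rewrite IHn// size_map.
case/splitPr : l0 ul ln => l1 l2 ul ln.
have pl : perm_eq (l1 ++ 0%N :: l2) (0%N :: (l1 ++ l2)).
  by rewrite (perm_catCA l1 [:: 0%N] l2).
have /= /andP[l0 ul'] : uniq (0%N :: (l1 ++ l2)) by rewrite -(perm_uniq pl).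
have /= ln' : all (fun i => i < n.+1)%N (0%N :: (l1 ++ l2)) by rewrite -(perm_all _ pl).
have [u a e] := shift _ l0 ul' ln'.
have insE x s : [seq nth 0%R (x :: s) i | i <- l1 ++ 0%N :: l2] =
    insert_at (size l1) (x :: [seq nth (0%R : V) s i | i <- map predn (l1 ++ l2)]).
  rewrite /= -(e x) !map_cat /= take_size_cat ?size_map//.
  by rewrite drop_size_cat ?size_map.
under eq_fun do under eq_fun do rewrite insE.
have -> : size (l1 ++ 0%N :: l2) = (size (l1 ++ l2)).+1 by rewrite !size_cat/= addnS.
rewrite -(@unifE_insert_at _ (size l1)) ?size_cat ?leq_addr// -size_cat.
rewrite unifE_S; last exact: seq_nnm_insert.
rewrite /EW; apply: eq_integral => x _; congr (_ * _).
rewrite -(size_map predn (l1 ++ l2)) -IHn//.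
exact: (seq_nnm_cons x (seq_nnm_insert (size l1) mh)).
Qed.

Lemma eq_unifE n f g : (forall s, size s = n -> f s = g s) -> unifE W n f = unifE W n g.
Proof.
elim: n f g => [|n IHn] f g fg; first exact: fg.
congr (@lebint R k.+2 _); apply/funext => x; congr (_ * _).
by apply: IHn => s sn; apply: fg; rewrite /= sn.
Qed.

Lemma seq_nnmZ c h : 0 <= c -> seq_nnm h -> seq_nnm (fun s => c * h s).
Proof.
move=> c0 [h0 mh]; split => [s|d T Xs mXs]; first exact: mule_ge0.
exact: measurable_funeM (mh _ _ _ mXs).
Qed.

Lemma seq_nnmD f g : seq_nnm f -> seq_nnm g -> seq_nnm (fun s => f s + g s).
Proof.
move=> [f0 mf] [g0 mg]; split => [s|d T Xs mXs]; first exact: adde_ge0.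
by apply: emeasurable_funD; [exact: mf|exact: mg].
Qed.

Lemma seq_nnm0 : seq_nnm (fun=> 0). Proof. by split. Qed.

Lemma seq_nnm_sum I (r : seq I) (f : I -> seq V -> \bar R) :
  (forall i, seq_nnm (f i)) -> seq_nnm (fun s => \sum_(i <- r) f i s).
Proof.
move=> mf; elim: r => [|i r IH].
  by under eq_fun do rewrite big_nil; exact: seq_nnm0.
by under eq_fun do rewrite big_cons; exact: seq_nnmD.
Qed.

Lemma nnm_unifE_cons n h : seq_nnm h ->
  nnm (fun x => (\1_W x)%:E * unifE W n (fun r => h (x :: r))).
Proof.
move=> mh; apply: nnmM; first exact: nW.
exact: (seq_nnm_nnm (Xs := [:: id]) (f := fun x => [:: x]) (seq_nnm_unifE n mh)).
Qed.

Lemma unifEZ n c h : 0 <= c -> seq_nnm h -> unifE W n (fun s => c * h s) = c * unifE W n h.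
Proof.
move=> c0; elim: n h => [|n IHn] h mh //.
rewrite !unifE_S//; last exact: seq_nnmZ.
rewrite /EW -nnm_integralZl//; last exact: nnm_unifE_cons.
apply: eq_integral => x _; rewrite muleCA; congr (_ * _).
by rewrite IHn//; exact: seq_nnm_cons.
Qed.

Lemma unifED n f g : seq_nnm f -> seq_nnm g ->
  unifE W n (fun s => f s + g s) = unifE W n f + unifE W n g.
Proof.
elim: n f g => [|n IHn] f g mf mg //.
rewrite !unifE_S//; last exact: seq_nnmD.
rewrite /EW -nnm_integralD//; [|exact: nnm_unifE_cons|exact: nnm_unifE_cons].
apply: eq_integral => x _; rewrite -ge0_muleDr; [|by apply: unifE_ge0; exact: seq_nnm_cons..].
by congr (_ * _); rewrite IHn//; exact: seq_nnm_cons.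
Qed.

Lemma unifE0 n : unifE W n (fun=> 0) = 0.
Proof.
elim: n => [|n IHn] //; rewrite unifE_S; last exact: seq_nnm0.
by rewrite /EW; apply: integral0_eq => x _; rewrite IHn mule0.
Qed.

Lemma unifE_sum n I (r : seq I) (f : I -> seq V -> \bar R) : (forall i, seq_nnm (f i)) ->
  unifE W n (fun s => \sum_(i <- r) f i s) = \sum_(i <- r) unifE W n (f i).
Proof.
move=> mf; elim: r => [|i r IH].
  by rewrite big_nil; under eq_fun do rewrite big_nil; exact: unifE0.
rewrite big_cons -IH -unifED//; last exact: seq_nnm_sum.
by congr (unifE W n _); apply/funext => s; rewrite big_cons.
Qed.

Lemma le_unifE n f g : seq_nnm f -> seq_nnm g -> (forall s, f s <= g s) ->
  unifE W n f <= unifE W n g.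
Proof.
elim: n f g => [|n IHn] f g mf mg fg; first exact: fg.
rewrite !unifE_S//; apply: nnm_le_integral; [exact: nnm_unifE_cons..|move=> x].
by rewrite lee_wpmul2l ?lee_fin// IHn//; exact: seq_nnm_cons.
Qed.

Lemma seq_nnm_cst c : 0 <= c -> seq_nnm (fun=> c). Proof. by split. Qed.

Lemma unifE_cst n c : 0 <= c -> unifE W n (fun=> c) = c.
Proof.
move=> c0; elim: n => [|n IHn] //; rewrite unifE_S; last exact: seq_nnm_cst.
by rewrite -[RHS]EW_cst// /EW; apply: eq_integral => x _; rewrite IHn.
Qed.

End iid_points.

(** * Counting distinct indices; factorial moments *)

Section count.

(** A duplicate-free list leaves n - size l values for a new head; for such a list the
    natural-number subtraction is exact. *)
Lemma sum_uniq_cons n (l : seq 'I_n) :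
  (\sum_(i < n) uniq (i :: l) = uniq l * (n - size l))%N.
Proof.
case: (boolP (uniq l)) => ul /=; last first.
  by rewrite mul0n big1// => i _; rewrite (negPf ul) andbF.
rewrite mul1n.
transitivity (\sum_(i < n | i \in predC (mem l)) 1)%N.
  rewrite [RHS]big_mkcond/=; apply: eq_bigr => i _.
  by rewrite ul andbT !inE; case: (i \in l).
rewrite sum1_card.
have e : (size l + #|predC (mem l)|)%N = n by rewrite -(card_uniqP ul) cardC card_ord.
by rewrite -[X in (X - _)%N]e addKn; apply: eq_card => i; rewrite !inE.
Qed.

Lemma sum_distinct4 n :
  (\sum_(i1 < n) \sum_(i2 < n) \sum_(i3 < n) \sum_(i4 < n)
     ([&& i1 != i2, i1 != i3, i1 != i4, i2 != i3, i2 != i4 & i3 != i4] : nat)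
   = n ^_ 4)%N.
Proof.
(* The list is reversed so that the innermost index is its head and the sums can be evaluated from
   the inside out. *)
transitivity (\sum_(i1 < n) \sum_(i2 < n) \sum_(i3 < n) \sum_(i4 < n)
     (uniq [:: i4; i3; i2; i1]))%N.
  apply: eq_bigr => i1 _; apply: eq_bigr => i2 _; apply: eq_bigr => i3 _.
  apply: eq_bigr => i4 _; congr nat_of_bool.
  rewrite /= !inE !negb_or !andbT (eq_sym i4 i3) (eq_sym i4 i2) (eq_sym i4 i1).
  rewrite (eq_sym i3 i2) (eq_sym i3 i1) (eq_sym i2 i1).
  by do ![case: (_ == _)].
under eq_bigr do under eq_bigr do under eq_bigr do rewrite sum_uniq_cons [size _]/=.
under eq_bigr do under eq_bigr do rewrite -big_distrl sum_uniq_cons [size _]/=.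
under eq_bigr do rewrite -!big_distrl sum_uniq_cons [size _]/=.
rewrite -!big_distrl/= sum_nat_const card_ord !ffactnSr ffactn0 mul1n subn0.
by rewrite muln1.
Qed.

End count.

Section poisson.
Context {R : realType}.
Local Open Scope ereal_scope.

(** The m-th factorial moment of the Poisson law is t^m: the first m terms vanish, and shifting by m
    turns (n + m) ^_ m / (n + m)! into 1 / n!, leaving the exponential series. *)
Lemma poisson_ffact (t c : R) (m : nat) : (0 <= t)%R -> (0 <= c)%R ->
  \sum_(n <oo) ((expR (- t) * t ^+ n / n`!%:R)%:E * (c * (n ^_ m)%:R)%:E)
  = (c * t ^+ m)%:E.
Proof.
move=> t0 c0.
pose a n := ((expR (- t) * t ^+ n / n`!%:R)%:E * (c * (n ^_ m)%:R)%:E).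
have am n : a (n + m)%N = (c * t ^+ m * expR (- t) * exp_coeff t n)%:E.
  rewrite /a -EFinM; congr EFin.
  have f0 : (n`!%:R != 0 :> R)%R by rewrite pnatr_eq0 -lt0n fact_gt0.
  have f1 : ((n + m)`!%:R != 0 :> R)%R by rewrite pnatr_eq0 -lt0n fact_gt0.
  have := ffact_fact (leq_addl n m); rewrite addnK => /(congr1 (fun i => i%:R : R)%R).
  rewrite natrM => e; rewrite /exp_coeff/= exprD.
  have fE : (((n + m) ^_ m)%:R = (n + m)`!%:R / n`!%:R :> R)%R by rewrite -e mulfK.
  by rewrite fE; field; rewrite f0 f1.
have a0 n : (n < m)%N -> a n = 0.
  by move=> nm; rewrite /a ffact_small// mulr0 mule0.
have S n : \sum_(0 <= i < n + m) a i =
    (c * t ^+ m * expR (- t) * series (exp_coeff t) n)%:E.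
  rewrite (big_cat_nat (leq0n m) (leq_addl n m))/= big_nat big1 ?add0e; last first.
    by move=> i /andP[_ im]; exact: a0.
  rewrite -{1}(add0n m) big_addn addnK /series/= mulr_sumr -sumEFin.
  by apply: eq_bigr => i _; exact: am.
apply/cvg_lim => //; rewrite -(cvg_shiftn m) /=.
under eq_fun do rewrite S.
apply: cvg_EFin; first by near=> n.
rewrite /comp/=.
rewrite [X in _ --> X](_ : _ = c * t ^+ m * expR (- t) * expR t)%R; last first.
  by rewrite -mulrA -expRD addNr expR0 mulr1.
apply: (@cvgM _ _ _ _ (fun=> c * t ^+ m * expR (- t))%R (series (exp_coeff t))).
  exact: cvg_cst.
exact: is_cvg_series_exp_coeff.
Unshelve. all: by end_near.
Qed.

End poisson.

(** * The expectation as a multiple of a four-point probability *)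

Section expectation.
Context {R : realType} (k : nat) (Q : 'M[R]_(k.+2)) (W : set 'rV[R]_(k.+2)).
Local Notation V := 'rV[R]_(k.+2).
Local Open Scope ereal_scope.

Definition projM : 'M[R]_(k.+2) := Q^T *m pid_mx 2 *m Q.

Lemma projLE (x : V) : projL Q x = x *m projM.
Proof. by rewrite /projL /projM !mulmxA. Qed.

Lemma crossLE (v1 v2 v3 v4 : V) : crossL Q v1 v2 v3 v4 <->
  segments_meet (v1 *m projM) (v2 *m projM) (v3 *m projM) (v4 *m projM).
Proof.
rewrite /crossL /segments_meet; rewrite -!segment_lin.
by rewrite (_ : projL Q = fun x => x *m projM)//; apply/funext => x; exact: projLE.
Qed.

Definition hit (delta : R) (v1 v2 v3 v4 : V) : bool :=
  `[< crossL Q v1 v2 v3 v4 >] && (enorm (v1 - v2) <= delta)%R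
    && (enorm (v3 - v4) <= delta)%R.

Lemma measurable_hit d (T : measurableType d) delta (X1 X2 X3 X4 : T -> V) :
  measurable_fun setT X1 -> measurable_fun setT X2 ->
  measurable_fun setT X3 -> measurable_fun setT X4 ->
  measurable [set t | hit delta (X1 t) (X2 t) (X3 t) (X4 t)].
Proof.
move=> m1 m2 m3 m4.
rewrite (_ : [set t | _] =
  [set t | segments_meet (X1 t *m projM) (X2 t *m projM) (X3 t *m projM) (X4 t *m projM)]
  `&` ([set t | enorm (X1 t - X2 t) <= delta]%R `&` [set t | enorm (X3 t - X4 t) <= delta]%R)).
  apply: measurableI; last apply: measurableI.
  - by apply: measurable_segments_meet; exact: measurable_mulmxV.
  - by apply: measurable_enorm_le; apply: measurable_addV => //; exact: measurable_oppV.
  - by apply: measurable_enorm_le; apply: measurable_addV => //; exact: measurable_oppV.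
apply/seteqP; split => t; rewrite /hit /=.
  by move=> /andP[/andP[/asboolP/crossLE ? ?] ?].
by move=> [/crossLE/asboolP -> [-> ->]].
Qed.

(** Read as a functional of lists so that [unifE_select] applies; it is integrated over lists of
    length 4, where the default 0 never occurs. *)
Definition hits (delta : R) (s : seq V) : \bar R :=
  (hit delta (nth 0%R s 0) (nth 0%R s 1) (nth 0%R s 2) (nth 0%R s 3))%:R%:E.

Lemma seq_nnm_hits delta : seq_nnm (hits delta).
Proof.
have nE d (T : measurableType d) (Xs : seq (T -> V)) i t :
    nth 0%R [seq X t | X <- Xs] i = nth (fun _ => 0%R) Xs i t.
  by elim: Xs i => [|X Xs IH] [|i]//=.
split=> [s|d T Xs mXs]; first by rewrite lee_fin.
rewrite /hits; under eq_fun do rewrite !nE.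
by apply: (proj1 (nnm_bool _)); apply: measurable_hit; exact: all_measurable_nth.
Qed.

Hypothesis mW : measurable W.

Definition hit_prob (delta : R) : \bar R :=
  EW W (fun v1 => EW W (fun v2 => EW W (fun v3 => EW W (fun v4 =>
    (hit delta v1 v2 v3 v4)%:R%:E)))).

Lemma unifE_hits delta : unifE W 4 (hits delta) = hit_prob delta.
Proof.
have m0 := seq_nnm_hits delta.
rewrite (unifE_S mW _ m0); apply: eq_integral => v1 _; congr (_ * _).
have m1 := seq_nnm_cons v1 m0.
rewrite (unifE_S mW _ m1); apply: eq_integral => v2 _; congr (_ * _).
have m2 := seq_nnm_cons v2 m1.
rewrite (unifE_S mW _ m2); apply: eq_integral => v3 _; congr (_ * _).
have m3 := seq_nnm_cons v3 m2.
by rewrite (unifE_S mW _ m3); apply: eq_integral => v4 _; congr (_ * _).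
Qed.

Hypothesis W1 : lebm k.+2 W = 1.

Lemma hit_prob_fin delta : hit_prob delta \is a fin_num.
Proof.
rewrite -unifE_hits ge0_fin_numE; last by apply: unifE_ge0 => //; exact: seq_nnm_hits.
apply: (@le_lt_trans _ _ 1); last exact: ltry.
rewrite -[leRHS](unifE_cst mW W1 4 lee01).
apply: le_unifE => //; first exact: seq_nnm_hits.
by move=> s; rewrite lee_fin lern1 leq_b1.
Qed.

(** Each of the n ^_ 4 tuples of distinct indices contributes the same probability, by
    [unifE_select]. *)
Lemma unifE_crL delta n :
  unifE W n (fun s => (crL Q delta s)%:E) = (8^-1 * (n ^_ 4)%:R)%:E * hit_prob delta.
Proof.
pose dist (i1 i2 i3 i4 : 'I_n) :=
  [&& i1 != i2, i1 != i3, i1 != i4, i2 != i3, i2 != i4 & i3 != i4].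
pose F (i1 i2 i3 i4 : 'I_n) (s : seq V) : \bar R :=
  (8^-1 * (dist i1 i2 i3 i4)%:R)%:E *
   hits delta [seq nth 0%R s i | i <- [:: i1 : nat; i2 : nat; i3 : nat; i4 : nat]].
have c0 i1 i2 i3 i4 : 0 <= (8^-1 * (dist i1 i2 i3 i4)%:R)%:E :> \bar R.
  by rewrite lee_fin mulr_ge0.
have mh l : seq_nnm (fun s => hits delta [seq nth 0%R s i | i <- l]).
  exact: seq_nnm_nth (seq_nnm_hits delta).
have mF i1 i2 i3 i4 : seq_nnm (F i1 i2 i3 i4) by exact: seq_nnmZ.
rewrite (@eq_unifE _ _ _ _ _ (fun s =>
   \sum_(i1 < n) \sum_(i2 < n) \sum_(i3 < n) \sum_(i4 < n) F i1 i2 i3 i4 s)); last first.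
  move=> s sn; subst n; rewrite /crL mulr_sumr -sumEFin; apply: eq_bigr => i1 _.
  rewrite mulr_sumr -sumEFin; apply: eq_bigr => i2 _.
  rewrite mulr_sumr -sumEFin; apply: eq_bigr => i3 _.
  rewrite mulr_sumr -sumEFin; apply: eq_bigr => i4 _.
  rewrite /F /hits -EFinM -mulrA -natrM mulnb; congr (_ * (nat_of_bool _)%:R)%:E.
  by rewrite /hit /dist /= !andbA.
rewrite unifE_sum//; last by move=> i; do 3!apply: seq_nnm_sum => ?.
transitivity (\sum_(i1 < n) \sum_(i2 < n) \sum_(i3 < n) \sum_(i4 < n)
    (8^-1 * fine (hit_prob delta) * (dist i1 i2 i3 i4)%:R)%:E).
  apply: eq_bigr => i1 _; rewrite unifE_sum//; last by move=> i; do 2!apply: seq_nnm_sum => ?.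
  apply: eq_bigr => i2 _; rewrite unifE_sum//; last by move=> i; apply: seq_nnm_sum => ?.
  apply: eq_bigr => i3 _; rewrite unifE_sum//.
  apply: eq_bigr => i4 _; rewrite /F unifEZ//.
  rewrite -mulrA (mulrC (fine _)) mulrA [RHS]EFinM fineK ?hit_prob_fin//.
  case: (boolP (dist _ _ _ _)) => dd; last by rewrite mulr0 !mul0e.
  congr (_ * _); rewrite -unifE_hits.
  rewrite (unifE_select mW W1 _ _ (seq_nnm_hits delta))//.
    move: dd => /and5P[a b c e /andP[f g]].
    by rewrite /= !inE !negb_or andbT; apply/and3P; split; rewrite ?a ?b ?c ?e ?f ?g.
  by rewrite /= !ltn_ord.
under eq_bigr do under eq_bigr do under eq_bigr do rewrite sumEFin -mulr_sumr.
under eq_bigr do under eq_bigr do rewrite sumEFin -mulr_sumr.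
under eq_bigr do rewrite sumEFin -mulr_sumr.
rewrite sumEFin -mulr_sumr -[hit_prob delta in RHS]fineK ?hit_prob_fin// -EFinM; congr EFin.
rewrite -(sum_distinct4 n) natr_sum -!mulrA; congr (_ * _)%R.
rewrite mulrC; congr (_ * _)%R.
apply: eq_bigr => i1 _; rewrite natr_sum; apply: eq_bigr => i2 _.
by rewrite natr_sum; apply: eq_bigr => i3 _; rewrite natr_sum.
Qed.

Lemma EcrE delta t : (0 <= t)%R -> Ecr Q W delta t = (8^-1 * t ^+ 4)%:E * hit_prob delta.
Proof.
move=> t0; rewrite /Ecr.
under eq_eseriesr do rewrite unifE_crL.
rewrite -[hit_prob delta]fineK ?hit_prob_fin//.
under eq_eseriesr do rewrite muleA muleC.
rewrite nneseriesZl; last first.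
  move=> n _; rewrite -EFinM lee_fin.
  by apply: mulr_ge0; apply: mulr_ge0 => //; apply: mulr_ge0; rewrite ?expR_ge0 ?exprn_ge0.
by rewrite poisson_ffact// 1?muleC.
Qed.

End expectation.

(** * Rescaling *)

Section frame.
Context {R : realType} (k : nat) (Q : 'M[R]_(k.+2)).
Hypothesis QQ : Q *m Q^T = 1%:M.
Local Notation V := 'rV[R]_(k.+2).

Let QQ' : Q^T *m Q = 1%:M. Proof. exact: mulmx1C. Qed.

(** Orthonormal coordinates adapted to L: u along L and w along L^perp. [projE] reads off the
    L-coordinates. *)
Definition emb (u : 'rV[R]_2) (w : 'rV[R]_k) : V := (row_mx u w : 'rV[R]_(2 + k)) *m Q.

Definition projE (v : V) : 'rV[R]_2 := lsubmx (v *m Q^T : 'rV[R]_(2 + k)).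

Lemma emb_projEK u w : projE (emb u w) = u.
Proof. by rewrite /projE /emb -mulmxA QQ mulmx1 row_mxKl. Qed.

Lemma emb_surj v : exists w, v = emb (projE v) w.
Proof.
exists (rsubmx (v *m Q^T : 'rV[R]_(2 + k))).
by rewrite /emb /projE hsubmxK -mulmxA QQ' mulmx1.
Qed.

Lemma embLE u w : embL Q u + embLp Q w = emb u w.
Proof.
by rewrite /embL /embLp /emb -mulmxDl; congr (_ *m Q); rewrite (@add_row_mx _ 1 2 k) addr0 add0r.
Qed.

Lemma embL_emb u : embL Q u = emb u 0. Proof. by []. Qed.

Lemma emb_projM u w : emb u w *m projM Q = embL Q u.
Proof.
rewrite /projM /emb !mulmxA -(mulmxA _ Q) QQ mulmx1; congr (_ *m Q).
have -> : pid_mx 2 = block_mx 1%:M 0 0 0 :> 'M[R]_(2 + k) by rewrite -pid_mx_block.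
by rewrite (@mul_row_block _ 1 2 k 2 k) !mulmx0 mulmx1 !addr0.
Qed.

Lemma projM_projE v : v *m projM Q = embL Q (projE v).
Proof. by have [w {1}->] := emb_surj v; exact: emb_projM. Qed.

Lemma embD u u' w w' : emb (u + u') (w + w') = emb u w + emb u' w'.
Proof. by rewrite /emb -(@add_row_mx _ 1 2 k) mulmxDl. Qed.

Lemma embZ c u w : emb (c *: u) (c *: w) = c *: emb u w.
Proof. by rewrite /emb -(@scale_row_mx _ 1 2 k) -scalemxAl. Qed.

Lemma enorm_emb u w : enorm (emb u w) = Num.sqrt (enorm u ^+ 2 + enorm w ^+ 2).
Proof.
rewrite enorm_orth// /enorm !sqr_sqrtr ?sumr_ge0//; try by move=> *; exact: sqr_ge0.
congr Num.sqrt; have /= -> := @big_split_ord R 0 +%R 2 k xpredT (fun i => (row_mx u w : 'rV[R]_(2 + k)) ord0 i ^+ 2); congr (_ + _).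
  by apply: eq_bigr => i _; rewrite row_mxEl.
by apply: eq_bigr => i _; rewrite row_mxEr.
Qed.

Lemma enorm_embL u : enorm (embL Q u) = enorm u.
Proof.
rewrite embL_emb enorm_emb; have -> : enorm (0 : 'rV[R]_k) = 0.
  by rewrite /enorm big1 ?sqrtr0// => i _; rewrite mxE expr0n.
by rewrite expr0n addr0 sqrtr_sqr ger0_norm// enorm_ge0.
Qed.

Lemma enorm_projE v : enorm (projE v) <= enorm v.
Proof.
have [w {2}->] := emb_surj v; rewrite enorm_emb -{1}[enorm (projE v)]ger0_norm ?enorm_ge0//.
by rewrite -sqrtr_sqr ler_sqrt ?addr_ge0 ?sqr_ge0// lerDl sqr_ge0.
Qed.

(** Summing (a - b)^2 <= 2 a^2 + 2 b^2 over the coordinates gives at most 4, which is enough for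
    this case of the triangle inequality. *)
Lemma enormB_le n (a b : 'rV[R]_n) : enorm a <= 1 -> enorm b <= 1 -> enorm (a - b) <= 2.
Proof.
have e (x : 'rV[R]_n) : enorm x <= 1 -> \sum_i x ord0 i ^+ 2 <= 1.
  move=> x1; rewrite -[leLHS]sqr_sqrtr ?sumr_ge0//; last by move=> i _; exact: sqr_ge0.
  by rewrite expr_le1// sqrtr_ge0.
move=> /e a1 /e b1.
have -> : 2 = Num.sqrt (2 ^+ 2) :> R by rewrite sqrtr_sqr ger0_norm.
rewrite ler_sqrt ?sqr_ge0//.
apply: (@le_trans _ _ (\sum_i (2 * a ord0 i ^+ 2 + 2 * b ord0 i ^+ 2))).
  by apply: ler_sum => i _; rewrite !mxE; have := sqr_ge0 (a ord0 i + b ord0 i); nra.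
rewrite big_split/= -!mulr_sumr; lra.
Qed.

Definition crossing (x : V) (y : 'rV[R]_2) (z : V) : bool :=
  `[< segments_meet 0 (x *m projM Q) (embL Q y) (embL Q y + z *m projM Q) >].

(** A common point of the two segments gives y = a x' - b z' with a, b in [0, 1] and x', z' the
    projections of x and z, both of norm at most 1. This is the origin of the disc of radius 2 in
    c_d. *)
Lemma crossing_le2 x y z : enorm x <= 1 -> enorm z <= 1 -> crossing x y z -> enorm y <= 2.
Proof.
move=> x1 z1 /asboolP/segments_meetP[a [b [/andP[a0 a1] /andP[b0 b1]]]] e.
have -> : enorm y = enorm (a *: (x *m projM Q) - b *: (z *m projM Q)).
  rewrite -enorm_embL; congr enorm.
  have : embL Q y = a *: (x *m projM Q) - b *: (z *m projM Q)
     - ((1 - a) *: 0 + a *: (x *m projM Q) - ((1 - b) *: embL Q y + b *: (embL Q y + z *m projM Q))).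
    by apply/rowP => i; rewrite !mxE; ring.
  by rewrite e subr0.
have n1 c v : 0 <= c -> c <= 1 -> enorm v <= 1 -> enorm (c *: (v *m projM Q)) <= 1.
  move=> c0 c1 v1; rewrite enormZ// mulr_ile1 ?enorm_ge0//.
  by rewrite projM_projE enorm_embL (le_trans (enorm_projE v)).
by apply: enormB_le; exact: n1.
Qed.

(** After projection w disappears, and the configuration is the image of (0, x, y, y + z) under
    scaling by delta and translation by the projection of v. The bound on y comes from
    [crossing_le2]. *)
Lemma hit_rescaled (delta : R) v x y z w : 0 < delta ->
  hit Q delta v (delta *: x + v) (emb (delta *: y + projE v) w)
      (delta *: z + emb (delta *: y + projE v) w)
  = [&& enorm x <= 1, enorm y <= 2, enorm z <= 1 & crossing x y z].
Proof.
move=> d0; rewrite /hit.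
have nE (a b : V) : (enorm (a - (delta *: b + a)) <= delta) = (enorm b <= 1).
  by rewrite opprD addrCA subrr addr0 enormN (enormZ _ (ltW d0)) ger_pMr.
rewrite !nE.
have -> : `[< crossL Q v (delta *: x + v) (emb (delta *: y + projE v) w)
      (delta *: z + emb (delta *: y + projE v) w) >] = crossing x y z.
  apply: asbool_equiv_eq; rewrite crossLE -[X in _ <-> X](segments_meet_affine (embL Q (projE v)) _ _ _ _ (lt0r_neq0 d0)).
  rewrite !mulmxDl emb_projM (projM_projE v) scaler0 addr0 scalerDr.
  have -> : embL Q (delta *: y + projE v) = embL Q (projE v) + delta *: embL Q y.
    by rewrite !embL_emb -embZ -embD scaler0 addr0 addrC.
  by rewrite -!scalemxAl [delta *: (x *m _) + _]addrC [delta *: (z *m _) + _]addrC addrA.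
case: (boolP (enorm x <= 1)) => x1; rewrite ?andbF//= ?andbF//.
case: (boolP (enorm z <= 1)) => z1; rewrite ?andbF//= !andbT.
by apply/idP/andP => [c|[]//]; split => //; exact: crossing_le2 c.
Qed.

End frame.

(** * Fibres of the projection and neighbourhoods of W *)

Section slices.
Context {R : realType} (k : nat) (Q : 'M[R]_(k.+2)) (W : set 'rV[R]_(k.+2)).
Hypothesis QQ : Q *m Q^T = 1%:M.
Local Notation V := 'rV[R]_(k.+2).
Local Open Scope ereal_scope.

Lemma measurable_emb d (T : measurableType d) (u : T -> 'rV[R]_2) (w : T -> 'rV[R]_k) :
  measurable_fun setT u -> measurable_fun setT w ->
  measurable_fun setT (fun t => emb Q (u t) (w t)).
Proof. by move=> mu mw; apply: measurable_mulmxV; exact: (@measurable_row_mxV _ _ _ 2 k). Qed.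

Lemma measurable_projE d (T : measurableType d) (v : T -> V) :
  measurable_fun setT v -> measurable_fun setT (fun t => projE Q (v t)).
Proof.
move=> mv; apply/measurable_fun_rVP => i.
under eq_fun do rewrite mxE.
exact: (measurable_coord _ (measurable_mulmxV Q^T mv)).
Qed.

Lemma lebm_emb (f : V -> \bar R) : nnm f ->
  \int[lebm k.+2]_v f v = \int[lebm 2]_u \int[lebm k]_w f (emb Q u w).
Proof.
move=> mf; rewrite -(lebm_orth QQ mf) lebm_split//.
by apply: (nnm_comp mf); exact: measurable_mulmxV.
Qed.

Lemma compact_box (cW : compact W) : exists M, W `<=` box M.
Proof.
have [M [_ WM]] := compact_bounded cW.
exists (`|M| + 2)%R => x Wx i.
have xM : (`|x| <= `|M| + 1)%R.
  by apply: WM => //; rewrite (le_lt_trans (ler_norm _))// ltrDl.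
have : ball (0%R : V) (`|M| + 2)%R x.
  by rewrite mx_norm_ball /ball_/= sub0r normrN (le_lt_trans xM)// ltrD2l ltr1n.
by move=> [_ /(_ ord0 i)]; rewrite mxE /ball/= sub0r normrN => /ltW.
Qed.

Hypothesis cW : compact W.

Let clW : closed W. Proof. by apply: compact_closed => //; exact: norm_hausdorff. Qed.
Lemma mcompact : measurable W. Proof. exact: closed_measurable_rV. Qed.
Let mW := mcompact.

Hypothesis W1 : lebm k.+2 W = 1.

Let A (v : V) : \bar R := (\1_W v)%:E.
Let cA (v : V) : \bar R := (\1_(~` W) v)%:E.

Let nA d (T : measurableType d) (X : T -> V) : measurable_fun setT X -> nnm (fun t => A (X t)).
Proof. by move=> mX; exact: nnm_indic. Qed.

Let ncA d (T : measurableType d) (X : T -> V) : measurable_fun setT X -> nnm (fun t => cA (X t)).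
Proof. by move=> mX; apply: nnm_indic => //; exact: measurableC. Qed.

Let A0 v : 0 <= A v. Proof. by rewrite lee_fin. Qed.

Lemma slice_bounded : exists2 C : R, (0 <= C)%R &
  forall u, \int[lebm k]_w A (emb Q u w) <= C%:E.
Proof.
have [M WM] := compact_box cW.
(* A rotated box is not a box, so the bound passes through the Euclidean norm: [N] bounds that norm
   on the box containing W, and with it the norm of w. *)
pose N := Num.sqrt (\sum_(i < k.+2) M ^+ 2).
exists ((2 * Num.max 0 N) ^+ k)%R; first by rewrite exprn_ge0// mulr_ge0// le_max lexx.
move=> u; have mS : measurable [set w | W (emb Q u w)].
  rewrite -[X in measurable X]setTI.
  by apply: (measurable_emb (u := fun=> u) (w := id)).
apply: le_trans (lebm_bounded mS _); last first.
  move=> w /= /WM bw i; apply: (le_trans (le_coord_enorm w i)).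
  have -> : enorm w = Num.sqrt (enorm w ^+ 2) by rewrite sqrtr_sqr ger0_norm// enorm_ge0.
  apply: (@le_trans _ _ (enorm (emb Q u w))).
    by rewrite enorm_emb// ler_sqrt ?addr_ge0 ?sqr_ge0// lerDr sqr_ge0.
  rewrite /enorm ler_sqrt; last by apply: sumr_ge0 => j _; exact: sqr_ge0.
  apply: ler_sum => j _; rewrite -real_normK ?num_real// ler_sqr ?nnegrE//.
  by rewrite (le_trans _ (bw j)).
by rewrite -integral_indicT.
Qed.

(** Integral over pairs of points with the same projection to L: the second point is
    [emb Q (projE Q v) w]. *)
Definition slice_integral (f : V -> 'rV[R]_k -> \bar R) := \int[lebm k.+2]_v \int[lebm k]_w f v w.

Lemma slice_integral_ge0 f : (forall v w, 0 <= f v w) -> 0 <= slice_integral f.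
Proof. by move=> f0; apply: integral_ge0 => v _; exact: integral_ge0. Qed.

Lemma slice_integralD f g : nnm (fun p : V * 'rV[R]_k => f p.1 p.2) ->
  nnm (fun p : V * 'rV[R]_k => g p.1 p.2) ->
  slice_integral (fun v w => f v w + g v w) = slice_integral f + slice_integral g.
Proof.
move=> mf mg; rewrite /slice_integral -nnm_integralD; [|exact: nnm_int..].
apply: eq_integral => v _; rewrite nnm_integralD//.
  exact: (nnm_comp mf (pair1_measurable v)).
exact: (nnm_comp mg (pair1_measurable v)).
Qed.

Lemma le_slice_integral f g : nnm (fun p : V * 'rV[R]_k => f p.1 p.2) ->
  nnm (fun p : V * 'rV[R]_k => g p.1 p.2) ->
  (forall v w, f v w <= g v w) -> slice_integral f <= slice_integral g.
Proof.
move=> mf mg fg; apply: nnm_le_integral; [exact: nnm_int..|move=> v].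
apply: nnm_le_integral; [|exact: (nnm_comp mg (pair1_measurable v))|exact: fg].
exact: (nnm_comp mf (pair1_measurable v)).
Qed.

Let mq d (T : measurableType d) (v : T -> V) (w : T -> 'rV[R]_k) :
  measurable_fun setT v -> measurable_fun setT w ->
  measurable_fun setT (fun t => emb Q (projE Q (v t)) (w t)).
Proof. by move=> mv mw; apply: measurable_emb => //; exact: measurable_projE. Qed.

(** With u fixed, the two points range independently over one fibre. The point confined to W
    contributes at most C, and the other one together with u rebuilds the full integral of g. *)
Lemma slice_integral_bound C g : nnm g -> (0 <= C)%R ->
  (forall u, \int[lebm k]_w A (emb Q u w) <= C%:E) ->
  slice_integral (fun v w => A v * g (emb Q (projE Q v) w)) <= C%:E * \int[lebm k.+2]_v g v.
Proof.
move=> mg C0 AC.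
have mgu u : nnm (fun w => g (emb Q u w)).
  by apply: (nnm_comp mg); exact: (measurable_emb (u := fun=> u) (w := id)).
have mge : nnm (fun p : 'rV[R]_2 * 'rV[R]_k => g (emb Q p.1 p.2)).
  by apply: (nnm_comp mg); exact: measurable_emb.
have n1 : nnm (fun u => \int[lebm k]_w g (emb Q u w)) by exact: nnm_int.
have g0 u : 0 <= \int[lebm k]_w g (emb Q u w).
  by apply: integral_ge0 => w _; exact: (mgu u).2.
have -> : slice_integral (fun v w => A v * g (emb Q (projE Q v) w)) =
    \int[lebm k.+2]_v (A v * \int[lebm k]_w g (emb Q (projE Q v) w)).
  by apply: eq_integral => v _; rewrite nnm_integralZl.
rewrite lebm_emb; last first.
  apply: nnmM; first exact: nA.
  by apply: nnm_int; apply: (nnm_comp mg); exact: mq.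
under eq_integral do under eq_integral do rewrite emb_projEK//.
rewrite lebm_emb// -(nnm_integralZl _ (c := C%:E) _ n1) ?lee_fin//.
apply: nnm_le_integral.
- apply: nnm_int; apply: nnmM; first by apply: nA; exact: measurable_emb.
  exact: (nnm_comp n1 measurable_fst).
- by apply: nnmM; [exact: nnm_cst|exact: nnm_int].
- move=> u; rewrite nnm_integralZr//; last by apply: nA; exact: (measurable_emb (u := fun=> u) (w := id)).
  by rewrite lee_wpmul2r.
Qed.

(** Same bound with the roles exchanged; the point confined to W is now the inner variable, so the
    fibre bound applies directly. *)
Lemma slice_integral_boundl C g : nnm g -> (0 <= C)%R ->
  (forall u, \int[lebm k]_w A (emb Q u w) <= C%:E) ->
  slice_integral (fun v w => g v * A (emb Q (projE Q v) w)) <= C%:E * \int[lebm k.+2]_v g v.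
Proof.
move=> mg C0 AC; rewrite -nnm_integralZl ?lee_fin//; apply: nnm_le_integral.
- apply: nnm_int; apply: nnmM; first exact: (nnm_comp mg).
  by apply: nA; exact: mq.
- by apply: nnmM => //; exact: nnm_cst.
- move=> v; rewrite nnm_integralZl; [|exact: mg.2|]; last first.
    by apply: nA; exact: (mq (v := fun=> v) (w := id)).
  by rewrite muleC lee_wpmul2r// mg.2.
Qed.

(** Neighbourhood for the sup norm, in which [ball] is taken; as a union of open balls it is open,
    hence measurable. *)
Definition thick (r : R) : set V := \bigcup_(q in W) ball q r.

Lemma measurable_thick r : measurable (thick r).
Proof.
apply: open_measurable_rV; apply: bigcup_open => q _; exact: ball_open.
Qed.

Let mthickD r : measurable (thick r `\` W).
Proof. by apply: measurableD => //; exact: measurable_thick. Qed.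

(** The sets for r = 1 / (n + 1) decrease to the empty set, because a point adherent to the closed
    set W lies in W. Continuity from above applies since the first set is bounded and so has finite
    measure. *)
Lemma thick_cvg0 (e : R) : (0 < e)%R ->
  exists2 r : R, (0 < r)%R & lebm k.+2 (thick r `\` W) <= e%:E.
Proof.
move=> e0; pose F n := thick n.+1%:R^-1 `\` W.
have F0 : \bigcap_n F n = set0.
  apply/seteqP; split => // v Fv.
  have nWv : ~ W v by have [] := Fv 0%N I.
  apply: nWv; rewrite ((closure_id W).1 clW) => U /nbhs_ballP[r /= r0 rU].
  have [n _ /(_ n (leqnn n)) nr] := near_infty_natSinv_lt (PosNum r0).
  have [[q Wq qv] _] := Fv n I.
  exists q; split => //; apply: rU; apply: ball_sym.
  exact: le_ball (ltW nr) _ qv.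
have mono : nonincreasing_seq F.
  move=> m n mn; apply/subsetPset => v [[q Wq qv] nW]; split => //.
  exists q => //; apply: le_ball qv.
  by rewrite lef_pV2 ?posrE// ler_nat ltnS.
have Ffin : lebm k.+2 (F 0%N) < +oo.
  have [M WM] := compact_box cW.
  apply: (@le_lt_trans _ _ ((2 * Num.max 0 (M + 1)) ^+ k.+2)%:E); last exact: ltry.
  apply: lebm_bounded => [|v [[q Wq [_ qv]] _] i]; first exact: mthickD.
  have := qv ord0 i; rewrite /ball/= invr1 => qvi.
  have qM := WM _ Wq i.
  rewrite -[v _ _](subKr (q ord0 i)) (le_trans (ler_normB _ _))//.
  by rewrite lerD// ltW.
have := nonincreasing_cvg_mu Ffin (fun n => mthickD _).
rewrite F0 => /(_ measurable0 mono); rewrite measure0 => /fine_cvgP[fn cv].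
have [n [fn_ lt_]] := filter_ex (filterI fn (cvgr_lt _ cv _ e0)).
exists n.+1%:R^-1%R; first by rewrite invr_gt0.
by rewrite -[leLHS]fineK// lee_fin ltW.
Qed.

(** A point v outside W with v + h in W is within r of W. *)
Lemma int_shift_out (h : V) r : ball (0%R : V) r h ->
  \int[lebm k.+2]_v (cA v * A (v + h)%R) <= lebm k.+2 (thick r `\` W).
Proof.
move=> hr; rewrite -[leRHS]integral_indicT//.
apply: nnm_le_integral => [||v].
- by apply: nnmM; [exact: ncA|apply: nA; exact: measurable_addV].
- by apply: nnm_indic.
rewrite /A /cA -EFinM lee_fin !indicE -natrM mulnb ler_nat.
case: (boolP (_ && _)) => //= /andP; rewrite !inE => -[nWv Wvh].
rewrite mem_set//; split => //; exists (v + h)%R => //.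
move: hr; rewrite !mx_norm_ball /ball_/= sub0r normrN.
by rewrite addrAC subrr add0r.
Qed.

(* W and its translate have the same volume, so the part of W that a shift moves out of W is as
   large as the part of the complement that it moves in. *)
Lemma int_shift_in (h : V) r : ball (0%R : V) r h ->
  \int[lebm k.+2]_v (A v * cA (v + h)%R) <= lebm k.+2 (thick r `\` W).
Proof.
move=> hr; apply: le_trans (int_shift_out hr).
have mh : measurable_fun setT (fun v : V => (v + h)%R) by exact: measurable_addV.
have nAA : nnm (fun v => A v * A (v + h)%R) by apply: nnmM; [exact: nA|exact: nA].
have ncAA : nnm (fun v => cA v * A (v + h)%R) by apply: nnmM; [exact: ncA|exact: nA].
have nAcA : nnm (fun v => A v * cA (v + h)%R) by apply: nnmM; [exact: nA|exact: ncA].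
have IA : \int[lebm k.+2]_v A v = 1 by rewrite -W1; exact: integral_indicT.
have AcA v : A v + cA v = 1.
  by rewrite /A /cA !indicE in_setC -EFinD -natrD; case: (v \in W).
have e1 : \int[lebm k.+2]_v (A v * A (v + h)%R) + \int[lebm k.+2]_v (A v * cA (v + h)%R) = 1.
  rewrite -nnm_integralD// -IA; apply: eq_integral => v _.
  by rewrite -ge0_muleDr// ?AcA ?mule1// lee_fin.
have e2 : \int[lebm k.+2]_v (A v * A (v + h)%R) + \int[lebm k.+2]_v (cA v * A (v + h)%R) = 1.
  rewrite -nnm_integralD// -IA -(lebm_shift h); [|by case: (nA (@measurable_id _ V setT))|by []].
  apply: eq_integral => v _.
  by rewrite -ge0_muleDl// ?AcA ?mul1e// lee_fin.
have fin : \int[lebm k.+2]_v (A v * A (v + h)%R) \is a fin_num.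
  rewrite ge0_fin_numE; last by apply: integral_ge0 => v _; rewrite mule_ge0.
  apply: (@le_lt_trans _ _ 1); last exact: ltry.
  by rewrite -e1 leeDl// integral_ge0// => v _; exact: nAcA.2.
by rewrite -(addeK (\int[lebm k.+2]_v (A v * cA (v + h)%R)) fin) [X in X - _]addeC e1 -e2 [X in X - _]addeC addeK.
Qed.

End slices.

(** Syntax-directed measurability of vector-valued maps; the case [emb ?Q ?u] serves goals whose
    variable was removed by eta-reduction. *)
Ltac mmap := lazymatch goal with
  | |- measurable_fun _ (fun t => @GRing.add _ _ _) => apply: measurable_addV; mmap
  | |- measurable_fun _ (fun t => @GRing.opp _ _) => apply: measurable_oppV; mmap
  | |- measurable_fun _ (fun t => @GRing.scale _ _ _ _) => apply: measurable_scaleV; mmap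
  | |- measurable_fun _ (fun t => emb _ _ _) => apply: measurable_emb; mmap
  | |- measurable_fun _ (emb ?Q ?u) =>
      apply: (@measurable_emb _ _ Q _ _ (fun=> u) id); mmap
  | |- measurable_fun _ (fun t => projE _ _) => apply: measurable_projE; mmap
  | |- measurable_fun _ (fun t => mulmx _ _) => apply: measurable_mulmxV; mmap
  | |- measurable_fun _ (fun t => fst (fst _)) =>
      apply: (measurableT_comp measurable_fst); mmap
  | |- measurable_fun _ (fun t => snd (fst _)) =>
      apply: (measurableT_comp measurable_snd); mmap
  | |- _ => first [exact: measurable_cst | exact: measurable_id | exact: measurable_fst
                  | exact: measurable_snd | idtac]
  end.

Lemma lebmZl (R : realType) n (c : \bar R) (f : 'rV[R]_n -> \bar R) :
  (0 <= c)%E -> nnm f -> (c * \int[lebm n]_x f x = \int[lebm n]_x (c * f x))%E.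
Proof. by move=> c0 nf; rewrite nnm_integralZl. Qed.

Lemma eq_lebint (R : realType) n (f g : 'rV[R]_n -> \bar R) :
  (forall x, f x = g x) -> lebint f = lebint g.
Proof. by move=> /funext ->. Qed.

(** * Substitution at scale delta *)

Section change_of_variables.
Context {R : realType} (k : nat) (Q : 'M[R]_(k.+2)).
Hypothesis QQ : Q *m Q^T = 1%:M.
Local Notation V := 'rV[R]_(k.+2).
Local Open Scope ereal_scope.

Variable F : V -> V -> V -> V -> \bar R.
(** Quantifying over the parameter space lets the hypothesis be used after any number of partial
    integrations. *)
Hypothesis nF : forall d (T : measurableType d) (a b c e : T -> V),
  measurable_fun setT a -> measurable_fun setT b ->
  measurable_fun setT c -> measurable_fun setT e ->
  nnm (fun t => F (a t) (b t) (c t) (e t)).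

Local Ltac nint := cbv beta; repeat (apply: nnm_int; cbv beta); apply: nF; cbv beta; mmap.

Variables (delta : R) (d0 : (0 < delta)%R).

Let cV (f : V -> \bar R) h : nnm f ->
  \int[lebm k.+2]_x f x = (delta ^+ k.+2)%:E * \int[lebm k.+2]_x f (delta *: x + h)%R.
Proof. by move=> [mf f0]; exact: lebm_affine. Qed.

Let cL (f : V -> \bar R) h : nnm f ->
  \int[lebm k.+2]_x f x = (delta ^+ 2)%:E *
    \int[lebm 2]_y \int[lebm k]_w f (emb Q (delta *: y + h)%R w).
Proof.
move=> nf; rewrite (lebm_emb QQ nf).
have [mg g0] : nnm (fun u => \int[lebm k]_w f (emb Q u w)).
  by apply: nnm_int; apply: (nnm_comp nf); exact: measurable_emb.
by rewrite (lebm_affine h d0 mg g0).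
Qed.

Let c0 n : 0 <= (delta ^+ n)%:E. Proof. by rewrite lee_fin exprn_ge0// ltW. Qed.

(** With d = k + 2, the points v2 and v4 give delta^d each and the L-part of v3 gives delta^2; its
    L^perp-part w is not rescaled. Hence the exponent 2d + 2. Tonelli then moves v and w inside, so
    that x, y, z are the outer variables. *)
Lemma change_of_variables :
  \int[lebm k.+2]_v1 \int[lebm k.+2]_v2 \int[lebm k.+2]_v3 \int[lebm k.+2]_v4 F v1 v2 v3 v4
  = (delta ^+ (2 * k.+2 + 2))%:E *
    \int[lebm k.+2]_x \int[lebm 2]_y \int[lebm k.+2]_z
      \int[lebm k.+2]_v \int[lebm k]_w
        F v (delta *: x + v)%R (emb Q (delta *: y + projE Q v)%R w)
          (delta *: z + emb Q (delta *: y + projE Q v) w)%R.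
Proof.
pose G (v x : V) (y : 'rV[R]_2) (w : 'rV[R]_k) (z : V) : \bar R := F v (delta *: x + v)%R (emb Q (delta *: y + projE Q v)%R w)
          (delta *: z + emb Q (delta *: y + projE Q v) w)%R.
transitivity ((delta ^+ (2 * k.+2 + 2))%:E * \int[lebm k.+2]_v \int[lebm k.+2]_x
    \int[lebm 2]_y \int[lebm k]_w \int[lebm k.+2]_z G v x y w z); last first.
  congr (_ * _); rewrite tonelli; last by rewrite /G; nint.
  apply: eq_integral => x _; rewrite tonelli; last by rewrite /G; nint.
  apply: eq_integral => y _.
  transitivity (\int[lebm k.+2]_v \int[lebm k.+2]_z \int[lebm k]_w G v x y w z).
    by apply: eq_integral => v _; rewrite tonelli//; rewrite /G; nint.
  apply: etrans (tonelli _ _ _) _; last by [].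
  by rewrite /G; nint.
rewrite lebmZl//; last by rewrite /G; nint.
apply: eq_integral => v1 _.
rewrite (@cV _ v1); last by nint.
have -> : (delta ^+ (2 * k.+2 + 2) = delta ^+ k.+2 * (delta ^+ 2 * delta ^+ k.+2))%R.
  by rewrite -!exprD; congr (_ ^+ _)%R; lia.
rewrite [in RHS]EFinM -muleA; congr (_ * _).
rewrite [in RHS]EFinM -muleA.
rewrite (lebmZl (c0 k.+2)); last by rewrite /G; nint.
rewrite (lebmZl (c0 2)); last by apply: nnmM; [exact: nnm_cst|rewrite /G; nint].
apply: eq_integral => x _.
rewrite (@cL _ (projE Q v1)); last by nint.
congr (_ * _).
rewrite lebmZl//; last by rewrite /G; nint.
apply: eq_integral => y _.
rewrite lebmZl//; last by rewrite /G; nint.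
apply: eq_integral => w _.
by rewrite (@cV _ (emb Q (delta *: y + projE Q v1)%R w)); last by nint.
Qed.

End change_of_variables.

(** * Asymptotics *)

Section asymptotics.
Context {R : realType} (k : nat) (Q : 'M[R]_(k.+2)) (W : set 'rV[R]_(k.+2)).
Hypothesis QQ : Q *m Q^T = 1%:M.
Hypothesis cW : compact W.
Hypothesis W1 : lebm k.+2 W = 1%E.
Local Notation V := 'rV[R]_(k.+2).
Local Open Scope ereal_scope.

Let mW : measurable W := mcompact cW.
Let A (v : V) : \bar R := (\1_W v)%:E.
Let cA (v : V) : \bar R := (\1_(~` W) v)%:E.

Let nA d (T : measurableType d) (X : T -> V) : measurable_fun setT X -> nnm (fun t => A (X t)).
Proof. by move=> mX; exact: nnm_indic. Qed.

Let ncA d (T : measurableType d) (X : T -> V) : measurable_fun setT X -> nnm (fun t => cA (X t)).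
Proof. by move=> mX; apply: nnm_indic => //; exact: measurableC. Qed.

Let A0 v : 0 <= A v. Proof. by rewrite lee_fin. Qed.

Let IA : \int[lebm k.+2]_v A v = 1. Proof. by rewrite -W1; exact: integral_indicT. Qed.

Definition pairs : \bar R := slice_integral (fun v w => A v * A (emb Q (projE Q v) w)).

(* With h1 = delta x, h2 = delta y and h3 = delta (y + z), this is Phi_delta(x,y,z). *)
Definition pairs_shifted (h1 h2 h3 : V) : \bar R := slice_integral (fun v w =>
  A v * A (v + h1)%R * (A (emb Q (projE Q v) w + h2)%R * A (emb Q (projE Q v) w + h3)%R)).

Lemma pairs_shifted_ge0 h1 h2 h3 : 0 <= pairs_shifted h1 h2 h3.
Proof. by apply: slice_integral_ge0 => v w; rewrite !mule_ge0. Qed.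

Lemma pairs_ge0 : 0 <= pairs.
Proof. by apply: slice_integral_ge0 => v w; rewrite mule_ge0. Qed.

Section bounds.
Variable C : R.
Hypothesis C0 : (0 <= C)%R.
Hypothesis AC : forall u, \int[lebm k]_w A (emb Q u w) <= C%:E.

Lemma pairs_fin : pairs \is a fin_num.
Proof.
rewrite ge0_fin_numE ?pairs_ge0//; apply: le_lt_trans (ltry C).
have := slice_integral_bound QQ cW (nA (@measurable_id _ V setT)) C0 AC.
by rewrite IA mule1.
Qed.

Variables (r : R) (h1 h2 h3 : V).
Hypotheses (rh1 : ball (0%R : V) r h1) (rh2 : ball (0%R : V) r h2) (rh3 : ball (0%R : V) r h3).
Let eta : \bar R := lebm k.+2 (thick W r `\` W).

Let meta : measurable (thick W r `\` W).
Proof. by apply: measurableD => //; exact: measurable_thick. Qed.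

Let shift_thick v h : ball (0%R : V) r h -> W (v + h)%R -> thick W r v.
Proof.
move=> hr Wvh; exists (v + h)%R => //.
move: hr; rewrite !mx_norm_ball /ball_/= sub0r normrN.
by rewrite addrAC subrr add0r.
Qed.

(** Keep only the conditions on v and on q + h2, where q is the second point: it lies either in W,
    which gives [pairs], or in the thickening minus W, which costs C times the measure of that
    set. *)
Lemma pairs_shifted_le : pairs_shifted h1 h2 h3 <= pairs + C%:E * eta.
Proof.
pose D (v : V) : \bar R := (\1_(thick W r `\` W) v)%:E.
have nD d (T : measurableType d) (X : T -> V) : measurable_fun setT X -> nnm (fun t => D (X t)).
  by move=> mX; exact: nnm_indic.
apply: (@le_trans _ _ (slice_integral (fun v w => A v * A (emb Q (projE Q v) w) + A v * D (emb Q (projE Q v) w)))).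
  apply: le_slice_integral.
  - by repeat (apply: nnmM); apply: nA; mmap.
  - by apply: nnmD; apply: nnmM; try apply: nA; try apply: nD; mmap.
  move=> v w; set q := emb _ _ _.
  rewrite /A /D -!EFinM -EFinD lee_fin !indicE -!natrM -natrD !mulnb ler_nat.
  case: (v \in W) => //=; case: (v + h1 \in W)%R => //=.
  case: (boolP (q \in W)) => //= qW; rewrite ?add0n; first by case: (_ && _).
  case: (boolP (q + h2 \in W)%R) => //= /set_mem qh; case: (_ \in _) => //=.
  rewrite mem_set//; split; first exact: shift_thick qh.
  by move=> /mem_set; apply/negP.
rewrite slice_integralD; last 2 first.
- by apply: nnmM; apply: nA; mmap.
- by apply: nnmM; [apply: nA|apply: nD]; mmap.
apply: leeD => //.
have := slice_integral_bound QQ cW (nD _ _ _ (@measurable_id _ V setT)) C0 AC.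
by rewrite integral_indicT.
Qed.

(** Union bound: if v and q lie in W but the shifted configuration fails, one of v + h1, q + h2, q +
    h3 has left W. Each event costs at most C times [eta], by [int_shift_in]. *)
Lemma pairs_le_shifted : pairs <= pairs_shifted h1 h2 h3 + (3 * C)%:E * eta.
Proof.
pose E h (v : V) : \bar R := A v * cA (v + h)%R.
have nE h d (T : measurableType d) (X : T -> V) : measurable_fun setT X -> nnm (fun t => E h (X t)).
  by move=> mX; apply: nnmM; [exact: nA|apply: ncA; mmap].
have eE h : ball (0%R : V) r h -> \int[lebm k.+2]_v E h v <= eta.
  by move=> rh; exact: int_shift_in.
pose q v w := emb Q (projE Q v) w.
have n1 : nnm (fun p : V * 'rV[R]_k => E h1 p.1 * A (q p.1 p.2)).
  by apply: nnmM; [apply: nE|apply: nA]; rewrite /q; mmap.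
have n2 h : nnm (fun p : V * 'rV[R]_k => A p.1 * E h (q p.1 p.2)).
  by apply: nnmM; [apply: nA|apply: nE]; rewrite /q; mmap.
have n0 : nnm (fun p : V * 'rV[R]_k => A p.1 * A (p.1 + h1)%R *
    (A (q p.1 p.2 + h2)%R * A (q p.1 p.2 + h3)%R)).
  by repeat (apply: nnmM); apply: nA; rewrite /q; mmap.
apply: (@le_trans _ _ (slice_integral (fun v w => (A v * A (v + h1)%R * (A (q v w + h2)%R * A (q v w + h3)%R)
   + E h1 v * A (q v w)) + (A v * E h2 (q v w) + A v * E h3 (q v w))))).
  apply: le_slice_integral.
  - by apply: nnmM; apply: nA; mmap.
  - by apply: nnmD; apply: nnmD.
  move=> v w; rewrite /E -/(q v w).
  rewrite /A /cA -!EFinM -!EFinD lee_fin !indicE !in_setC -!natrM -!natrD ler_nat.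
  case: (v \in W) => //; case: (q v w \in W) => //; rewrite !mulnb.
  by case: (v + h1 \in W)%R; case: (q v w + h2 \in W)%R; case: (q v w + h3 \in W)%R.
rewrite slice_integralD; [|exact: nnmD..].
rewrite slice_integralD// slice_integralD// -addeA; apply: leeD => //.
have -> : (3 * C)%:E * eta = C%:E * eta + (C%:E * eta + C%:E * eta).
  have -> : (3 * C = C + (C + C))%R by lra.
  by rewrite EFinD ge0_muleDl ?lee_fin ?addr_ge0// EFinD ge0_muleDl ?lee_fin.
have Ce x : x <= eta -> C%:E * x <= C%:E * eta by move=> xe; rewrite lee_wpmul2l ?lee_fin.
apply: leeD; last apply: leeD.
- apply: le_trans (Ce _ (eE _ rh1)).
  exact: (slice_integral_boundl cW (nE h1 _ _ _ (@measurable_id _ V setT))).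
- apply: le_trans (Ce _ (eE _ rh2)).
  exact: (slice_integral_bound QQ cW (nE h2 _ _ _ (@measurable_id _ V setT))).
- apply: le_trans (Ce _ (eE _ rh3)).
  exact: (slice_integral_bound QQ cW (nE h3 _ _ _ (@measurable_id _ V setT))).
Qed.

End bounds.

(** One factor of the squared fibre volume is unfolded into the points v of W over u; the other
    remains as the inner integral. *)
Lemma I2E : I2 Q W = pairs.
Proof.
pose s u := \int[lebm k]_w A (emb Q u w).
have ns : nnm s by apply: nnm_int; apply: nA; mmap.
have s0 u : 0 <= s u by exact: ns.2.
have volE u : vol [set w | W (embL Q u + embLp Q w)%R] = s u.
  have e : [set w | W (embL Q u + embLp Q w)%R] = [set w | W (emb Q u w)].
    by apply/seteqP; split => w /=; rewrite embLE.
  have mS : measurable [set w | W (emb Q u w)].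
    rewrite -[X in measurable X]setTI.
    by apply: (@measurable_emb _ _ Q _ _ (fun=> u) id).
  by rewrite e (lebm_volE mS) -integral_indicT.
have -> : I2 Q W = lebint (fun u => s u * s u).
  apply: eq_lebint => u; rewrite !volE indicE.
  (* Over a point u outside the projection of W the fibre misses W, so its volume is 0. *)
  case: (boolP (_ \in _)) => [|/negP h]; rewrite ?mul1e// mul0e.
  suff -> : s u = 0 by rewrite mul0e.
  apply: integral0_eq => w _; rewrite /A indicE memNset// => Ww.
  apply: h; rewrite inE; exists (emb Q u w) => //.
  by rewrite projLE emb_projM.
have [mss ss0] := nnmM ns ns.
rewrite (lebintE mss ss0) /pairs /slice_integral.
transitivity (\int[lebm k.+2]_v (A v * s (projE Q v))).
  rewrite (lebm_emb QQ); last first.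
    by apply: nnmM; [apply: nA|apply: (nnm_comp ns); exact: measurable_projE].
  apply: eq_integral => u _; under [RHS]eq_integral do rewrite emb_projEK//.
  by rewrite nnm_integralZr//; apply: nA; mmap.
apply: eq_integral => v _; rewrite nnm_integralZl//.
by apply: nA; mmap.
Qed.

Definition chi (x : V) (y : 'rV[R]_2) (z : V) : bool :=
  [&& enorm x <= 1, enorm y <= 2, enorm z <= 1 & crossing Q x y z]%R.

Lemma nnm_chi d (T : measurableType d) (x : T -> V) (y : T -> 'rV[R]_2) (z : T -> V) :
  measurable_fun setT x -> measurable_fun setT y -> measurable_fun setT z ->
  nnm (fun t => (chi (x t) (y t) (z t))%:R%:E : \bar R).
Proof.
move=> mx my mz; apply: nnm_bool.
have myL : measurable_fun setT (fun t => embL Q (y t)).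
  by apply: (@measurable_emb _ _ Q _ _ _ (fun=> 0%R)).
rewrite (_ : [set t | _] = [set t | enorm (x t) <= 1]%R `&` ([set t | enorm (y t) <= 2]%R `&`
  ([set t | enorm (z t) <= 1]%R `&` [set t | segments_meet (0 : V)%R (x t *m projM Q) (embL Q (y t))
      (embL Q (y t) + z t *m projM Q)%R]))).
  do 3!(apply: measurableI; first exact: measurable_enorm_le).
  by apply: measurable_segments_meet; mmap.
apply/seteqP; split => t /=; first by move=> /and4P[? ? ? /asboolP].
by move=> [? [? [? /asboolP ?]]]; apply/and4P.
Qed.

Definition chi_integral (f : V -> 'rV[R]_2 -> V -> \bar R) : \bar R :=
  \int[lebm k.+2]_x \int[lebm 2]_y \int[lebm k.+2]_z ((chi x y z)%:R%:E * f x y z).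

Lemma cdE : cd Q = chi_integral (fun _ _ _ => 1).
Proof.
pose b1 n (c : R) (x : 'rV[R]_n) : \bar R := (\1_[set x | enorm x <= c]%R x)%:E.
have nb n c d (T : measurableType d) (X : T -> 'rV[R]_n) :
    measurable_fun setT X -> nnm (fun t => b1 n c (X t)).
  by move=> mX; apply: nnm_indic => //; exact: (@measurable_enorm_le _ _ _ n id).
pose K (x : V) (y : 'rV[R]_2) (z : V) : \bar R := (crossing Q x y z)%:R%:E.
have chiE x y z : b1 _ 1%R x * (b1 _ 2%R y * (b1 _ 1%R z * K x y z)) = (chi x y z)%:R%:E.
  by rewrite /b1 /K -!EFinM !indicE -!natrM !mulnb; congr (nat_of_bool _)%:R%:E;
    rewrite !mem_setE.
have nK d (T : measurableType d) (x : T -> V) (y : T -> 'rV[R]_2) (z : T -> V) :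
    measurable_fun setT x -> measurable_fun setT y -> measurable_fun setT z ->
    nnm (fun t => K (x t) (y t) (z t)).
  move=> mx my mz; apply: nnm_bool.
  have myL : measurable_fun setT (fun t => embL Q (y t)).
    by apply: (@measurable_emb _ _ Q _ _ _ (fun=> 0%R)).
  rewrite (_ : [set t | _] = [set t | segments_meet (0 : V)%R (x t *m projM Q) (embL Q (y t))
      (embL Q (y t) + z t *m projM Q)%R]).
    by apply: measurable_segments_meet; mmap.
  by apply/seteqP; split => t /=; move/asboolP.
(* Translating the segment from 0 to the projection of z by y gives the segment whose two endpoints
   are translated. *)
have KE x y z : `[< segment 0%R (projL Q x) `&` [set (embL Q y + p)%R | p in segment 0%R (projL Q z)] !=set0 >]
    = crossing Q x y z.
  congr (`[< _ >]); rewrite /segments_meet !projLE; congr (_ `&` _ !=set0).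
  apply/seteqP; split => p /=.
    move=> [_ [s s01 <-] <-]; exists s => //.
    by apply/rowP => i; rewrite !mxE; ring.
  move=> [s s01 <-]; exists ((1 - s) *: 0 + s *: (z *m projM Q))%R; first by exists s.
  by apply/rowP => i; rewrite !mxE; ring.
have K0 x y z : 0 <= K x y z by rewrite lee_fin.
have b0 n c x : 0 <= b1 n c x by rewrite lee_fin.
transitivity (lebint (fun x : V => b1 _ 1%R x * lebint (fun y : 'rV[R]_2 => b1 _ 2%R y *
    lebint (fun z : V => b1 _ 1%R z * K x y z)))).
  rewrite /cd; apply: eq_lebint => x; rewrite -/(b1 _ 1%R x); apply: congr1.
  apply: eq_lebint => y; rewrite -/(b1 _ 2%R y); apply: congr1.
  apply: eq_lebint => z; rewrite -/(b1 _ 1%R z); apply: congr1.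
  by rewrite /K -KE.
have e3 x y : lebint (fun z : V => b1 _ 1%R z * K x y z) = \int[lebm k.+2]_z (b1 _ 1%R z * K x y z).
  have [? ?] : nnm (fun z : V => b1 _ 1%R z * K x y z) by apply: nnmM; [exact: nb|exact: nK].
  by rewrite lebintE.
have e2 x : lebint (fun y : 'rV[R]_2 => b1 _ 2%R y * lebint (fun z : V => b1 _ 1%R z * K x y z))
    = \int[lebm 2]_y \int[lebm k.+2]_z (b1 _ 2%R y * (b1 _ 1%R z * K x y z)).
  under eq_fun do rewrite e3.
  have [? ?] : nnm (fun y : 'rV[R]_2 => b1 _ 2%R y * \int[lebm k.+2]_z (b1 _ 1%R z * K x y z)).
    by apply: nnmM; [exact: nb|apply: nnm_int; apply: nnmM; [apply: nb|apply: nK]; mmap].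
  rewrite lebintE//; apply: eq_integral => y _.
  by rewrite lebmZl//; apply: nnmM; [exact: nb|exact: nK].
under eq_fun do rewrite e2.
have [? ?] : nnm (fun x : V => b1 _ 1%R x *
    \int[lebm 2]_y \int[lebm k.+2]_z (b1 _ 2%R y * (b1 _ 1%R z * K x y z))).
  apply: nnmM; first exact: nb.
  by do 2!apply: nnm_int; apply: nnmM; [apply: nb|apply: nnmM; [apply: nb|apply: nK]]; mmap.
rewrite lebintE//; apply: eq_integral => x _; rewrite lebmZl//; last first.
  by apply: nnm_int; apply: nnmM; [apply: nb|apply: nnmM; [apply: nb|apply: nK]]; mmap.
apply: eq_integral => y _; rewrite lebmZl//; last first.
  by apply: nnmM; [apply: nb|apply: nnmM; [apply: nb|apply: nK]]; mmap.
by apply: eq_integral => z _; rewrite mule1 chiE.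
Qed.

End asymptotics.

(** Pure arithmetic: with D = 3 C c the error is at most D eps / (D + 1) <= eps, and the added 1
    keeps the denominator positive when D = 0. The upper bound on X also excludes X = +oo. *)
Lemma abse_sub_le (R : realType) (X c i e : \bar R) (C eps : R) : (0 <= C)%R -> (0 < eps)%R ->
  (0 <= X -> 0 <= c -> c \is a fin_num -> 0 <= i -> i \is a fin_num -> 0 <= e ->
  e <= (eps / (3 * C * fine c + 1))%:E ->
  X <= c * i + c * (C%:E * e) -> c * i <= X + c * ((3 * C)%:E * e) ->
  `|X - c * i| <= eps%:E)%E.
Proof.
move=> C0 eps0 X0 c0 cf i0 jf e0.
case: c c0 cf => [c| |]// c0 _; case: i i0 jf => [i| |]// i0 _; case: e e0 => [e| |]// e0.
case: X X0 => [X| |]// X0; rewrite -?EFinM -?EFinD ?leye_eq//.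
rewrite ?lee_fin/= in c0 i0 e0 X0 *.
move=> re up lo; rewrite ?lee_fin.
have Cc : 0 <= 3 * C * c by rewrite mulr_ge0// mulr_ge0.
have ce : 3 * C * c * e <= eps.
  apply: (@le_trans _ _ (3 * C * c * (eps / (3 * C * c + 1)))).
    by rewrite ler_wpM2l.
  by rewrite mulrA ler_pdivrMr ?ltr_wpDl// mulrC ler_wpM2l ?(ltW eps0)//; lra.
have eE : c * (3 * C * e) = 3 * C * c * e by ring.
have eE' : c * (C * e) = (3 * C * c * e) / 3 by field.
have p0 : 0 <= 3 * C * c * e by rewrite mulr_ge0.
by rewrite eE' in up; rewrite eE in lo; rewrite ler_norml; apply/andP; split; lra.
Qed.

(** * Convergence of the rescaled probability *)

Section conclusion.
Context {R : realType} (k : nat) (Q : 'M[R]_(k.+2)) (W : set 'rV[R]_(k.+2)).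
Hypothesis QQ : Q *m Q^T = 1%:M.
Hypothesis cW : compact W.
Hypothesis W1 : lebm k.+2 W = 1%E.
Local Notation V := 'rV[R]_(k.+2).
Local Open Scope ereal_scope.

Let mW : measurable W := mcompact cW.
Let A (v : V) : \bar R := (\1_W v)%:E.

Let nA d (T : measurableType d) (X : T -> V) : measurable_fun setT X -> nnm (fun t => A (X t)).
Proof. by move=> mX; exact: nnm_indic. Qed.

Let A0 v : 0 <= A v. Proof. by rewrite lee_fin. Qed.

Let H delta v1 v2 v3 v4 : \bar R := (hit Q delta v1 v2 v3 v4)%:R%:E.

Let nH delta d (T : measurableType d) (a b c e : T -> V) :
  measurable_fun setT a -> measurable_fun setT b ->
  measurable_fun setT c -> measurable_fun setT e ->
  nnm (fun t => H delta (a t) (b t) (c t) (e t)).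
Proof. by move=> ma mb mc me; apply: nnm_bool; exact: measurable_hit. Qed.

Lemma hit_prob_flat delta : hit_prob Q W delta =
  \int[lebm k.+2]_v1 \int[lebm k.+2]_v2 \int[lebm k.+2]_v3 \int[lebm k.+2]_v4
    (A v1 * A v2 * A v3 * (A v4 * H delta v1 v2 v3 v4)).
Proof.
apply: eq_integral => v1 _; rewrite -/(A v1) /EW lebmZl//; last first.
  apply: nnmM; first exact: nA.
  by do 2!apply: (nnm_EW mW); apply: nH; mmap.
apply: eq_integral => v2 _; rewrite -/(A v2) muleA lebmZl ?mule_ge0//; last first.
  apply: nnmM; first exact: nA.
  by apply: (nnm_EW mW); apply: nH; mmap.
apply: eq_integral => v3 _; rewrite -/(A v3) muleA lebmZl ?mule_ge0//.
by apply: nnmM; [exact: nA|apply: nH; mmap].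
Qed.

Let Phi delta (x : V) (y : 'rV[R]_2) (z : V) := pairs_shifted Q W (delta *: x)%R
  (delta *: embL Q y)%R (delta *: (embL Q y + z))%R.

Lemma hit_prob_rescaled delta : (0 < delta)%R ->
  hit_prob Q W delta = (delta ^+ (2 * k.+2 + 2))%:E * chi_integral Q (Phi delta).
Proof.
move=> d0; rewrite hit_prob_flat (change_of_variables QQ _ d0); last first.
  move=> d T a b c e ma mb mc me.
  apply: nnmM; last by apply: nnmM; [exact: nA|exact: nH].
  by repeat (apply: nnmM); exact: nA.
rewrite /chi_integral; apply: congr1.
apply: eq_integral => x _.
apply: eq_integral => y _.
apply: eq_integral => z _.
have qE v w : emb Q (delta *: y + projE Q v) w = (emb Q (projE Q v) w + delta *: embL Q y)%R.
  by rewrite embL_emb -embZ -embD scaler0 addr0 addrC.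
have n1 v : nnm (fun w => A v * A (v + delta *: x)%R *
    (A (emb Q (projE Q v) w + delta *: embL Q y)%R * A (emb Q (projE Q v) w + delta *: (embL Q y + z))%R)).
  by apply: nnmM; apply: nnmM; apply: nA; mmap.
rewrite /Phi /pairs_shifted /slice_integral lebmZl ?lee_fin//; last first.
  by apply: nnm_int; apply: nnmM; apply: nnmM; apply: nA; mmap.
apply: eq_integral => v _; rewrite lebmZl ?lee_fin//; last exact: n1.
apply: eq_integral => w _; rewrite /H hit_rescaled//.
have -> : (delta *: z + emb Q (delta *: y + projE Q v) w =
    emb Q (projE Q v) w + delta *: (embL Q y + z))%R.
  by rewrite qE scalerDr addrC -addrA.
rewrite qE [(delta *: x + v)%R]addrC -/(chi Q x y z) !muleA.
by rewrite muleC !muleA.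
Qed.

Definition nnm3 (f : V -> 'rV[R]_2 -> V -> \bar R) :=
  forall d (T : measurableType d) (x : T -> V) (y : T -> 'rV[R]_2) (z : T -> V),
    measurable_fun setT x -> measurable_fun setT y -> measurable_fun setT z ->
    nnm (fun t => f (x t) (y t) (z t)).

Lemma nnm3_ge0 f x y z : nnm3 f -> 0 <= f x y z.
Proof.
by move=> nf; have [_ /(_ 0%R)] := nf _ V (fun=> x) (fun=> y) (fun=> z) (measurable_cst _) (measurable_cst _) (measurable_cst _).
Qed.

Let nnm3_chi f : nnm3 f -> nnm3 (fun x y z => (chi Q x y z)%:R%:E * f x y z).
Proof. by move=> nf d T x y z mx my mz; apply: nnmM; [exact: nnm_chi|exact: nf]. Qed.

Lemma le_integral3 (f g : V -> 'rV[R]_2 -> V -> \bar R) : nnm3 f -> nnm3 g ->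
  (forall x y z, f x y z <= g x y z) ->
  \int[lebm k.+2]_x \int[lebm 2]_y \int[lebm k.+2]_z f x y z <=
  \int[lebm k.+2]_x \int[lebm 2]_y \int[lebm k.+2]_z g x y z.
Proof.
move=> nf ng fg.
apply: nnm_le_integral => [||x]; [by do 2!apply: nnm_int; apply: nf; mmap|by do 2!apply: nnm_int; apply: ng; mmap|].
apply: nnm_le_integral => [||y]; [by apply: nnm_int; apply: nf; mmap|by apply: nnm_int; apply: ng; mmap|].
by apply: nnm_le_integral => [||z]; [apply: nf; mmap|apply: ng; mmap|].
Qed.

Lemma le_chi_integral f g : nnm3 f -> nnm3 g ->
  (forall x y z, chi Q x y z -> f x y z <= g x y z) -> chi_integral Q f <= chi_integral Q g.
Proof.
move=> nf ng fg; apply: le_integral3; [exact: nnm3_chi..|move=> x y z].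
by case: (boolP (chi Q x y z)) => [/fg|]; rewrite ?mul0e// !mul1e.
Qed.

Lemma chi_integralD f g : nnm3 f -> nnm3 g ->
  chi_integral Q (fun x y z => f x y z + g x y z) = chi_integral Q f + chi_integral Q g.
Proof.
move=> nf0 ng0; have nf := nnm3_chi nf0; have ng := nnm3_chi ng0; rewrite /chi_integral.
rewrite -nnm_integralD; [|by do 2!apply: nnm_int; apply: nf; mmap|by do 2!apply: nnm_int; apply: ng; mmap].
apply: eq_integral => x _.
rewrite -nnm_integralD; [|by apply: nnm_int; apply: nf; mmap|by apply: nnm_int; apply: ng; mmap].
apply: eq_integral => y _.
rewrite -nnm_integralD; [|by apply: nf; mmap|by apply: ng; mmap].
by apply: eq_integral => z _; rewrite ge0_muleDr//; exact: nnm3_ge0.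
Qed.

Let nnm3_cst c : 0 <= c -> nnm3 (fun _ _ _ => c).
Proof. by move=> c0 d T x y z _ _ _; exact: nnm_cst. Qed.

Lemma chi_integral_cst c : 0 <= c -> chi_integral Q (fun _ _ _ => c) = cd Q * c.
Proof.
move=> c0; rewrite (cdE Q) /chi_integral.
have n1 := nnm3_chi (nnm3_cst lee01).
rewrite -nnm_integralZr//; last by do 2!apply: nnm_int; apply: n1; mmap.
apply: eq_integral => x _; rewrite -nnm_integralZr//; last by apply: nnm_int; apply: n1; mmap.
apply: eq_integral => y _; rewrite -nnm_integralZr//; last by apply: n1; mmap.
by apply: eq_integral => z _; rewrite mule1.
Qed.

(** The domain of integration is a product of three balls, each of finite volume. *)
Lemma cd_fin : cd Q \is a fin_num.
Proof.
have ub n c : measurable [set x : 'rV[R]_n | enorm x <= c]%R.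
  exact: (@measurable_enorm_le _ _ _ n id).
pose B n (c : R) : \bar R := lebm n [set x : 'rV[R]_n | enorm x <= c]%R.
have Bfin n c : B n c < +oo.
  apply: (le_lt_trans (lebm_bounded (ub n c) (_ : _ `<=` box c))); last exact: ltry.
  by move=> x xc i; exact: le_trans (le_coord_enorm x i) xc.
pose b n (c : R) (x : 'rV[R]_n) : \bar R := (\1_[set x | enorm x <= c]%R x)%:E.
have nb n c d (T : measurableType d) (X : T -> 'rV[R]_n) :
    measurable_fun setT X -> nnm (fun t => b n c (X t)).
  by move=> mX; apply: nnm_indic => //; exact: ub.
have Ib n c : \int[lebm n]_x b n c x = B n c by exact: (integral_indicT (lebm n) (ub n c)).
have B0 n c : 0 <= B n c by exact: measure_ge0.
rewrite ge0_fin_numE; last first.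
  rewrite cdE; apply: integral_ge0 => x _; apply: integral_ge0 => y _.
  by apply: integral_ge0 => z _; rewrite mule1 lee_fin.
apply: (@le_lt_trans _ _ (B k.+2 1%R * (B 2%N 2%R * B k.+2 1%R))); last first.
  by rewrite !lte_mul_pinfty ?ge0_fin_numE ?mule_ge0.
rewrite cdE; apply: (@le_trans _ _ (\int[lebm k.+2]_x \int[lebm 2]_y \int[lebm k.+2]_z
    (b _ 1%R x * (b _ 2%R y * b _ 1%R z)))).
  apply: le_integral3 => [||x y z].
  - exact: nnm3_chi (nnm3_cst lee01).
  - by move=> d T x y z mx my mz; apply: nnmM; [exact: nb|apply: nnmM; exact: nb].
  have mE n c (h : 'rV[R]_n) : (h \in [set h | enorm h <= c]%R) = (enorm h <= c)%R.
    by rewrite mem_setE.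
  rewrite mule1 /b -!EFinM lee_fin !indicE !mE -!natrM !mulnb ler_nat.
  by rewrite /chi; case: (enorm x <= 1)%R; case: (enorm y <= 2)%R; case: (enorm z <= 1)%R => //=;
    case: (crossing _ _ _ _).
rewrite le_eqVlt; apply/orP; left; apply/eqP.
have b0 n c x : 0 <= b n c x by rewrite lee_fin.
have I0 n c : 0 <= \int[lebm n]_x b n c x by rewrite Ib.
rewrite -!Ib -nnm_integralZr ?mule_ge0//; last exact: nb.
apply: eq_integral => x _.
rewrite -nnm_integralZr//; last exact: nb.
rewrite lebmZl//; last by apply: nnmM; [exact: nb|exact: nnm_cst].
apply: eq_integral => y _.
rewrite lebmZl//; last exact: nb.
rewrite lebmZl//.
by apply: nnmM; [exact: nnm_cst|exact: nb].
Qed.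

Lemma ball_coord n (r : R) (h : 'rV[R]_n) : (0 < r)%R ->
  (forall i, `|h ord0 i| < r)%R -> ball (0%R : 'rV[R]_n) r h.
Proof.
move=> r0 hr; split => // i j; rewrite (ord1 i) mxE /ball/= sub0r normrN; exact: hr.
Qed.

Lemma chi_integral_asymptotics (eps : R) : (0 < eps)%R -> exists2 r : R, (0 < r)%R &
  forall delta : R, (0 < delta < r)%R ->
    `| chi_integral Q (Phi delta) - cd Q * I2 Q W | <= eps%:E.
Proof.
move=> eps0; have [C C0 AC] := slice_bounded QQ cW.
pose c := fine (cd Q).
have cd0 : 0 <= cd Q.
  rewrite cdE; apply: integral_ge0 => x _; apply: integral_ge0 => y _.
  by apply: integral_ge0 => z _; rewrite mule1 lee_fin.
have c0 : (0 <= c)%R by rewrite fine_ge0.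
have D0 : (0 < 3 * C * c + 1)%R.
  by rewrite ltr_wpDl// mulr_ge0// mulr_ge0.
(* This accuracy for vol(W_r \ W) is the one that [abse_sub_le] requires. *)
have [r r0 re] := @thick_cvg0 _ _ _ cW _ (divr_gt0 eps0 D0).
(* Where chi holds, the coordinates of x, y and y + z are at most 1, 2 and 3 in absolute value, so
   all three shifts have sup norm at most 3 delta < r. *)
exists (r / 3)%R; first by rewrite divr_gt0.
move=> delta /andP[d0 dr].
have d3 : (delta * 3 < r)%R by rewrite -ltr_pdivlMr.
have nPhi : nnm3 (Phi delta).
  move=> d T x y z mx my mz.
  have myL : measurable_fun setT (fun t => embL Q (y t)).
    by apply: (@measurable_emb _ _ Q _ _ _ (fun=> 0%R)).
  have fs (U : T -> V) : measurable_fun setT U ->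
      measurable_fun setT (fun p : T * V * 'rV[R]_k => U p.1.1).
    by move=> mU; apply: (measurableT_comp mU); mmap.
  rewrite /Phi /pairs_shifted /slice_integral; do 2!apply: nnm_int.
  have fx := fs _ mx; have fyL := fs _ myL; have fz := fs _ mz.
  by apply: nnmM; apply: nnmM; apply: nA; mmap; first [exact: fx|exact: fyL|exact: fz].
have cdP f : nnm3 f -> forall e, 0 <= e -> nnm3 (fun x y z => f x y z + e).
  by move=> nf e e0 d T x y z mx my mz; apply: nnmD; [exact: nf|exact: nnm_cst].
have [eta etaE] : exists eta : \bar R, eta = lebm k.+2 (thick W r `\` W) by eexists.
have eta0 : 0 <= eta by rewrite etaE; exact: measure_ge0.
rewrite -etaE in re.
have balls x y z : chi Q x y z -> [/\ ball (0%R : V) r (delta *: x)%R,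
    ball (0%R : V) r (delta *: embL Q y)%R & ball (0%R : V) r (delta *: (embL Q y + z))%R].
  move=> /and4P[x1 y2 z1 _].
  have b (h : V) : (forall i, `|h ord0 i| <= 3)%R -> ball (0%R : V) r (delta *: h)%R.
    move=> h3; apply: ball_coord => // i; rewrite mxE normrM (gtr0_norm d0).
    by apply: le_lt_trans d3; rewrite ler_pM2l.
  have yi i : (`|embL Q y ord0 i| <= 2)%R.
    by rewrite (le_trans (le_coord_enorm _ _))// (enorm_embL QQ).
  split; apply: b => i.
  - by rewrite (le_trans (le_coord_enorm _ _))// (le_trans x1)// ler1n.
  - by rewrite (le_trans (yi i))// ler_nat.
  - rewrite mxE (le_trans (ler_normD _ _))//.
    have -> : (3 = 2 + 1 :> R)%R by lra.
    by rewrite lerD// (le_trans (le_coord_enorm _ _)).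
have I20 : 0 <= I2 Q W by rewrite (I2E QQ cW); exact: pairs_ge0.
have I2f : I2 Q W \is a fin_num by rewrite (I2E QQ cW); exact: pairs_fin C0 AC.
have Ce0 (e : R) : (0 <= e)%R -> 0 <= e%:E * eta.
  by move=> e0; apply: mule_ge0; [rewrite lee_fin|exact: eta0].
have up : chi_integral Q (Phi delta) <= cd Q * I2 Q W + cd Q * (C%:E * eta).
  have h := Ce0 C C0.
  rewrite -(ge0_muleDr _ I20 h) -(chi_integral_cst (adde_ge0 I20 h)).
  apply: le_chi_integral; [exact: nPhi|exact: (nnm3_cst (adde_ge0 I20 h))|].
  move=> x y z /balls[b1 b2 b3]; rewrite (I2E QQ cW) etaE.
  exact: pairs_shifted_le.
have lo : cd Q * I2 Q W <= chi_integral Q (Phi delta) + cd Q * ((3 * C)%:E * eta).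
  have h : 0 <= (3 * C)%:E * eta by apply: Ce0; rewrite mulr_ge0.
  rewrite -(chi_integral_cst I20) -(chi_integral_cst h) -(chi_integralD nPhi (nnm3_cst h)).
  apply: le_chi_integral; [exact: (nnm3_cst I20)|exact: cdP|].
  move=> x y z /balls[b1 b2 b3]; rewrite (I2E QQ cW) etaE.
  exact: pairs_le_shifted.
have X0 : 0 <= chi_integral Q (Phi delta).
  apply: integral_ge0 => x _; apply: integral_ge0 => y _; apply: integral_ge0 => z _.
  by apply: mule_ge0; [rewrite lee_fin|exact: pairs_shifted_ge0].
exact: abse_sub_le C0 eps0 X0 cd0 cd_fin I20 I2f eta0 re up lo.
Qed.

End conclusion.

(* d = k.+2 ; L = span of rows 0,1 of the orthogonal matrix Q *)
Theorem theorem1 (R : realType) (k : nat) (W : set 'rV[R]_(k.+2))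
  (W_compact : compact W)
  (W_convex : convex_set (W : set (convex_lmodType 'rV[R]_(k.+2))))
  (W_vol : vol W = 1%E)
  (Q : 'M[R]_(k.+2)) (Q_orth : Q *m Q^T = 1%:M)
  (delta : R -> R) (delta_pos : forall t, 0 < t -> 0 < delta t)
  (delta_to0 : delta t @[t --> +oo] --> 0) :
  forall eps : R, 0 < eps ->
    \forall t \near +oo,
      (`| Ecr Q W (delta t) t
          - (8^-1 * t ^+ 4 * delta t ^+ (2 * k.+2 + 2))%:E * cd Q * I2 Q W |
        <= (eps * (t ^+ 4 * delta t ^+ (2 * k.+2 + 2)))%:E)%E.
Proof.
move=> eps eps0.
have W1 : lebm k.+2 W = 1%E by rewrite -lebm_volE//; exact: mcompact.
have [r r0 rP] := chi_integral_asymptotics Q_orth W_compact W1 eps0.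
have dr : \forall t \near +oo, delta t < r by exact: (cvgr_lt _ delta_to0).
near=> t.
have t0 : 0 < t by near: t; exact: nbhs_pinfty_gt.
have d0 := delta_pos t t0.
have drt : delta t < r by near: t.
have T0 : 0 <= t ^+ 4 * delta t ^+ (2 * k.+2 + 2).
  by apply: mulr_ge0; apply: exprn_ge0; exact: ltW.
rewrite (EcrE Q (mcompact W_compact) W1 _ (ltW t0)) (hit_prob_rescaled Q_orth W_compact d0).
rewrite muleA -EFinM -muleA -mulrA.
have /rP : 0 < delta t < r by rewrite d0.
move: (chi_integral _ _) (cd Q * I2 Q W)%E (t ^+ 4 * _) T0 => X Y T T0.
(* An infinite value on either side would make the distance infinite, against the bound by eps. *)
case: X Y => [x| |] [y| |]//; rewrite -?EFinM !lee_fin => xy.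
rewrite -!mulrA -mulrBr normrM ger0_norm ?invr_ge0// -mulrBr normrM (ger0_norm T0).
(* The estimate is multiplied by T; the factor 1/8 on the left only helps. *)
have := ler_wpM2l T0 xy; have : 0 <= T * `|x - y| by rewrite mulr_ge0.
by lra.
Unshelve. all: by end_near.
Qed.
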